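(* Let $n\ge1$, and let $\mathcal H_m$ denote $\mathcal H_m(q,\infty)$ for all $m$, with $Z=\mathbb Z$, respectively (for a fixed integer $d\ge1$) $\mathcal H_m(q,d)$ for all $m$, with $Z=\mathbb Z_d:=\{0,1,\dots,d-1\}$. Every element of $\mathcal H_{n+1}$ can be written uniquely as a linear combination of words, each of one of the following types: 1$''$) $w_{n-1}$; 2$''$) $w_{n-1}\,g_ng_{n-1}\cdots g_i$, for $1\le i\le n$; 3$''$) $w_{n-1}\,g_ng_{n-1}\cdots g_{i+1}\,{t'_i}^{k}$, for $0\le i\le n-1$, $k\in Z$, $k\ne0$; 4$''$) $w_{n-1}\,{t'_n}^{k}$, for $k\in Z$, $k\neq0$; where $w_{n-1}$ is an element of $\mathcal H_n$. That is, the elements $1$; $g_n\cdots g_i$ ($1\le i\le n$); $g_n\cdots g_{i+1}{t'_i}^k$ ($0\le i\le n-1$, $k\in Z\setminus\{0\}$); ${t'_n}^k$ ($k\in Z\setminus\{0\}$) form a basis of $\mathcal H_{n+1}$ as a left $\mathcal H_n$-module.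
   Context: For $m\ge 1$, $B_{1,m}$ is the group with generators $t,\sigma_1,\dots,\sigma_{m-1}$ and relations $\sigma_1t\sigma_1t=t\sigma_1t\sigma_1$; $t\sigma_i=\sigma_it$ for $i>1$; $\sigma_i\sigma_j=\sigma_j\sigma_i$ for $|i-j|>1$; $\sigma_i\sigma_{i+1}\sigma_i=\sigma_{i+1}\sigma_i\sigma_{i+1}$ for $1\le i\le m-2$. Let $\mathcal R=\mathbb Z[q^{\pm1},u_1^{\pm1},\dots,u_d^{\pm1},\dots]$ with $q,u_1,u_2,\dots$ indeterminates. $\mathcal H_m(q,\infty)$ is the quotient of the group algebra $\mathcal R B_{1,m}$ by the relations $\sigma_i^2=(q-1)\sigma_i+q$ for all $i$. $\mathcal H_m(q,d)$ is the quotient of $\mathcal R B_{1,m}$ by the relations $\sigma_i^2=(q-1)\sigma_i+q$ for all $i$ and $(t-u_1)(t-u_2)\cdots(t-u_d)=0$. The image of $\sigma_i$ is denoted $g_i$. The natural inclusion $B_{1,m}\subset B_{1,m+1}$ induces an inclusion $\mathcal H_m\subset\mathcal H_{m+1}$. Put $t'_0:=t$ and $t'_i:=g_i\cdots g_1\,t\,g_1^{-1}\cdots g_i^{-1}$ for $i\ge1$. *)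

(* Defs.v *)
From HB Require Import structures.
From mathcomp Require Import all_boot all_algebra finmap.
From mathcomp Require Import boolp.
From mathcomp.multinomials Require Import xfinmap monalg.

Set Implicit Arguments.
Unset Strict Implicit.
Unset Printing Implicit Defensive.

Import GRing.Theory BigEnoughFSet.

Local Open Scope fset_scope.
Local Open Scope ring_scope.
Local Open Scope quotient_scope.

Section PresentedGroup.
Variable X : choiceType.

(* The letter (x, false) stands for x and (x, true) for its inverse. *)
Definition word := seq (X * bool).

Variable relator : word -> word -> Prop.

Inductive word_cong : word -> word -> Prop :=
| WordRel u v l r : relator l r -> word_cong (u ++ l ++ v) (u ++ r ++ v)
| WordCancel u v x b : word_cong (u ++ [:: (x, b); (x, ~~ b)] ++ v) (u ++ v)
| WordRefl w : word_cong w w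
| WordSym w1 w2 : word_cong w1 w2 -> word_cong w2 w1
| WordTrans w1 w2 w3 : word_cong w1 w2 -> word_cong w2 w3 -> word_cong w1 w3.

Definition word_eq (w1 w2 : word) : bool := `[< word_cong w1 w2 >].

Fact word_eq_refl : reflexive word_eq.
Proof. by move=> w; apply/asboolP; constructor. Qed.

Fact word_eq_sym : symmetric word_eq.
Proof. by move=> x y; apply/asboolP/asboolP; apply: WordSym. Qed.

Fact word_eq_trans : transitive word_eq.
Proof.
by move=> y x z /asboolP xy /asboolP yz; apply/asboolP; apply: WordTrans yz.
Qed.

Canonical word_equiv := EquivRel word_eq word_eq_refl word_eq_sym word_eq_trans.

Definition presGroup := {eq_quot word_equiv}.
HB.instance Definition _ := Choice.on presGroup.
HB.instance Definition _ := Quotient.on presGroup.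

Implicit Types (w : word) (g : presGroup).

Lemma pres_eqP w1 w2 :
  \pi_presGroup w1 = \pi_presGroup w2 <-> word_cong w1 w2.
Proof. by split=> [/eqmodP/asboolP|h] //; apply/eqmodP/asboolP. Qed.

Lemma word_cong_ctx a b w1 w2 :
  word_cong w1 w2 -> word_cong (a ++ w1 ++ b) (a ++ w2 ++ b).
Proof.
elim=> {w1 w2} [u v l r h|u v x s|w|w1 w2 _|w1 w2 w3 _ h1 _ h2].
- by rewrite -!catA !(catA a u); apply: WordRel.
- by rewrite -!catA !(catA a u); apply: WordCancel.
- exact: WordRefl.
- exact: WordSym.
- exact: WordTrans h1 h2.
Qed.

Lemma word_cong_cat w1 w2 w3 w4 :
  word_cong w1 w2 -> word_cong w3 w4 -> word_cong (w1 ++ w3) (w2 ++ w4).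
Proof.
move=> h12 h34; apply: (@WordTrans _ (w2 ++ w3)).
  exact: (@word_cong_ctx [::] w3).
by have := @word_cong_ctx w2 [::] _ _ h34; rewrite !cats0.
Qed.

Definition winv w : word := rev [seq (p.1, ~~ p.2) | p <- w].

Lemma word_cong_winv_l w : word_cong (winv w ++ w) [::].
Proof.
elim: w => [|[x b] w IHw]; first exact: WordRefl.
rewrite /winv /= rev_cons cat_rcons.
apply: WordTrans IHw; have := WordCancel (winv w) w x (~~ b).
by rewrite negbK.
Qed.

Lemma winvK : involutive winv.
Proof.
move=> w; rewrite /winv map_rev revK -map_comp map_id_in // => -[x b] _ /=.
by rewrite negbK.
Qed.

Lemma pres_ind (P : presGroup -> Prop) :
  (forall w, P (\pi_presGroup w)) -> forall g, P g.
Proof. by move=> Pw g; rewrite -[g]reprK. Qed.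

Definition pres_mul g1 g2 : presGroup := \pi_presGroup (repr g1 ++ repr g2).
Definition pres_inv g : presGroup := \pi_presGroup (winv (repr g)).
Definition pres_one : presGroup := \pi_presGroup [::].

Lemma repr_cong w : word_cong (repr (\pi_presGroup w)) w.
Proof. by apply/pres_eqP; rewrite reprK. Qed.

Lemma pres_mulE w1 w2 :
  pres_mul (\pi_presGroup w1) (\pi_presGroup w2) = \pi_presGroup (w1 ++ w2).
Proof. by apply/pres_eqP; apply: word_cong_cat; apply: repr_cong. Qed.

Fact pres_mulA : associative pres_mul.
Proof.
elim/pres_ind=> x; elim/pres_ind=> y; elim/pres_ind=> z.
by rewrite !pres_mulE catA.
Qed.

Fact pres_mul1 : left_id pres_one pres_mul.
Proof. by elim/pres_ind=> x; rewrite pres_mulE. Qed.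

Fact pres_mulr1 : right_id pres_one pres_mul.
Proof. by elim/pres_ind=> x; rewrite pres_mulE cats0. Qed.

Fact pres_mulV : left_inverse pres_one pres_inv pres_mul.
Proof.
move=> g; rewrite -{2}[g]reprK pres_mulE.
by apply/pres_eqP; apply: word_cong_winv_l.
Qed.

Fact pres_mulrV : right_inverse pres_one pres_inv pres_mul.
Proof.
move=> g; rewrite -{1}[g]reprK pres_mulE; apply/pres_eqP.
by have := word_cong_winv_l (winv (repr g)); rewrite winvK.
Qed.

HB.instance Definition _ := isGroup.Build presGroup
  pres_mulA pres_mul1 pres_mulr1 pres_mulV pres_mulrV.

Definition pres_gen (x : X) : presGroup := \pi_presGroup [:: (x, false)].

Section Lift.
Variables (H : groupType) (f : X -> H).

Definition letter_eval (p : X * bool) : H :=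
  if p.2 then (f p.1)^-1%g else f p.1.

Definition word_eval (w : word) : H :=
  \big[*%g/1%g]_(p <- w) letter_eval p.

Definition pres_lift (g : presGroup) : H := word_eval (repr g).

Hypothesis frel : forall l r, relator l r -> word_eval l = word_eval r.

Lemma word_eval_cat w1 w2 :
  word_eval (w1 ++ w2) = (word_eval w1 * word_eval w2)%g.
Proof. exact: big_cat. Qed.

Lemma word_eval_cong w1 w2 : word_cong w1 w2 -> word_eval w1 = word_eval w2.
Proof.
elim=> {w1 w2} [u v l r h|u v x b|w|w1 w2 _ ->|w1 w2 w3 _ -> _ ->] //.
  by rewrite !word_eval_cat (frel h).
rewrite !word_eval_cat; congr (_ * _)%g.
rewrite /word_eval big_cons big_seq1 /letter_eval.
by case: b => /=; rewrite ?mulVg ?mulgV mul1g.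
Qed.

Lemma pres_liftE w : pres_lift (\pi_presGroup w) = word_eval w.
Proof. exact: word_eval_cong (repr_cong w). Qed.

Lemma pres_lift_gen x : pres_lift (pres_gen x) = f x.
Proof. by rewrite pres_liftE /word_eval big_seq1. Qed.

Lemma pres_lift1 : pres_lift 1%g = 1%g.
Proof. by rewrite [LHS]pres_liftE /word_eval big_nil. Qed.

Lemma pres_liftM : {morph pres_lift : x y / (x * y)%g}.
Proof.
elim/pres_ind=> x; elim/pres_ind=> y.
by rewrite [(_ * _)%g]pres_mulE !pres_liftE word_eval_cat.
Qed.

End Lift.

End PresentedGroup.

(* {malg R[K]} only carries a product when K has no nontrivial units, so
   the convolution product is rebuilt here for groups. *)
Definition groupAlg (R : nzRingType) (G : groupType) := {malg R[G]}.

HB.lock Definition ga_of (R : nzRingType) (G : groupType) (g : G) :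
  groupAlg R G := << g >>.

Section GroupAlgebra.
Variables (R : nzRingType) (G : groupType).

HB.instance Definition _ := GRing.Lmodule.on (groupAlg R G).

Local Notation A := (groupAlg R G).
Implicit Types (x y z : A).

Local Notation ga_of := (@ga_of R G).

Definition ga_mul x y : A :=
  \sum_(g <- msupp x) \sum_(h <- msupp y) << x@_g * y@_h *g (g * h)%g >>.

Lemma ga_mulw (d1 d2 : {fset G}) x y : msupp x `<=` d1 -> msupp y `<=` d2 ->
  ga_mul x y = \sum_(g <- d1) \sum_(h <- d2) << x@_g * y@_h *g (g * h)%g >>.
Proof.
move=> le_d1 le_d2; rewrite /ga_mul (big_fset_incl _ le_d1) /=.
  apply/eq_bigr=> k1 _; apply/big_fset_incl => // k _ /mcoeff_outdom ->.
  by rewrite mulr0 monalgU0.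
move=> k _ /mcoeff_outdom g1k.
by rewrite big1 => // k' _; rewrite g1k mul0r monalgU0.
Qed.

Lemma ga_mulUU c1 c2 g1 g2 :
  ga_mul << c1 *g g1 >> << c2 *g g2 >> = << c1 * c2 *g (g1 * g2)%g >>.
Proof. by rewrite (ga_mulw msuppU_le msuppU_le) !big_seq_fset1 !mcoeffUU. Qed.

Fact ga_mulDl : left_distributive ga_mul +%R.
Proof.
move=> g1 g2 g.
rewrite [in LHS](ga_mulw (msuppD_le g1 g2) (fsubset_refl _)).
rewrite [ga_mul g1 g](ga_mulw (fsubsetUl _ (msupp g2)) (fsubset_refl _)).
rewrite [ga_mul g2 g](ga_mulw (fsubsetUr (msupp g1) _) (fsubset_refl _)).
rewrite -big_split /=; apply/eq_bigr=> k1 _.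
rewrite -big_split /=; apply/eq_bigr=> k2 _.
by rewrite mcoeffD mulrDl monalgUD.
Qed.

Fact ga_mulDr : right_distributive ga_mul +%R.
Proof.
move=> g g1 g2.
rewrite [in LHS](ga_mulw (fsubset_refl _) (msuppD_le g1 g2)).
rewrite [ga_mul g g1](ga_mulw (fsubset_refl _) (fsubsetUl _ (msupp g2))).
rewrite [ga_mul g g2](ga_mulw (fsubset_refl _) (fsubsetUr (msupp g1) _)).
rewrite -big_split /=; apply/eq_bigr=> k1 _.
rewrite -big_split /=; apply/eq_bigr=> k2 _.
by rewrite mcoeffD mulrDr monalgUD.
Qed.

Lemma ga_mul0l : left_zero 0 ga_mul.
Proof. by move=> g; rewrite /ga_mul msupp0 big_seq_fset0. Qed.

Lemma ga_mul0r : right_zero 0 ga_mul.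
Proof.
by move=> g; rewrite /ga_mul big1 // => k _; rewrite msupp0 big_seq_fset0.
Qed.

Lemma ga_suml I (r : seq I) (F : I -> A) y :
  ga_mul (\sum_(i <- r) F i) y = \sum_(i <- r) ga_mul (F i) y.
Proof. by apply: (big_morph (ga_mul^~ y)) => [x z|]; rewrite ?ga_mulDl ?ga_mul0l. Qed.

Lemma ga_sumr I (r : seq I) (F : I -> A) x :
  ga_mul x (\sum_(i <- r) F i) = \sum_(i <- r) ga_mul x (F i).
Proof. by apply: (big_morph (ga_mul x)) => [y z|]; rewrite ?ga_mulDr ?ga_mul0r. Qed.

Lemma ga_ind (P : A -> Prop) :
  (forall c g, P << c *g g >>) -> (forall x y, P x -> P y -> P (x + y)) ->
  forall x, P x.
Proof.
move=> PU PD x; rewrite [x]monalgE.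
elim: (enum_fset (msupp x)) => [|g s IHs]; last by rewrite big_cons; apply: PD.
by rewrite big_nil; have := PU 0 1%g; rewrite monalgU0.
Qed.

Fact ga_mulA : associative ga_mul.
Proof.
move=> x y z; elim/ga_ind: x => [a g|x1 x2 h1 h2]; last first.
  by rewrite !ga_mulDl h1 h2.
elim/ga_ind: y => [b h|y1 y2 h1 h2]; last first.
  by rewrite !(ga_mulDr, ga_mulDl) h1 h2.
elim/ga_ind: z => [c k|z1 z2 h1 h2]; last by rewrite !ga_mulDr h1 h2.
by rewrite !ga_mulUU mulrA mulgA.
Qed.

Fact ga_mul1l : left_id (ga_of 1%g) ga_mul.
Proof.
elim/ga_ind=> [a g|x1 x2 h1 h2]; last by rewrite ga_mulDr h1 h2.
by rewrite ga_of.unlock ga_mulUU mul1r mul1g.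
Qed.

Fact ga_mul1r : right_id (ga_of 1%g) ga_mul.
Proof.
elim/ga_ind=> [a g|x1 x2 h1 h2]; last by rewrite ga_mulDl h1 h2.
by rewrite ga_of.unlock ga_mulUU mulr1 mulg1.
Qed.

Fact ga_one_neq0 : ga_of 1%g != 0.
Proof. by rewrite ga_of.unlock monalgU_eq0 oner_eq0. Qed.

HB.instance Definition _ := GRing.Zmodule_isNzRing.Build (groupAlg R G)
  ga_mulA ga_mul1l ga_mul1r ga_mulDl ga_mulDr ga_one_neq0.

Lemma ga_ofM g h : ga_of (g * h)%g = ga_of g * ga_of h.
Proof. by rewrite ga_of.unlock [RHS]ga_mulUU mulr1. Qed.

Lemma ga_of1 : ga_of 1%g = 1.
Proof. by []. Qed.

Lemma ga_scaleU a c g : a *: (<< c *g g >> : A) = << a * c *g g >>.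
Proof. by apply/malgP=> k; rewrite mcoeffZ !mcoeffU mulrnAr. Qed.

Fact ga_scaleAl a x y : a *: (x * y) = (a *: x) * y.
Proof.
elim/ga_ind: x => [b g|x1 x2 h1 h2]; last first.
  by rewrite mulrDl !scalerDr mulrDl h1 h2.
elim/ga_ind: y => [c h|y1 y2 h1 h2]; last first.
  by rewrite !mulrDr scalerDr h1 h2.
by rewrite ga_scaleU ![_ * _ as X in _ = X]ga_mulUU [_ * _]ga_mulUU ga_scaleU mulrA.
Qed.

HB.instance Definition _ := GRing.Lmodule_isLalgebra.Build R (groupAlg R G)
  ga_scaleAl.

End GroupAlgebra.

Section GroupAlgebraCom.
Variables (R : comNzRingType) (G : groupType).

Local Notation A := (groupAlg R G).

Fact ga_scaleAr (a : R) (x y : A) : a *: (x * y) = x * (a *: y).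
Proof.
elim/ga_ind: x => [b g|x1 x2 h1 h2]; last by rewrite !mulrDl scalerDr h1 h2.
elim/ga_ind: y => [c h|y1 y2 h1 h2]; last first.
  by rewrite !(mulrDr, scalerDr) h1 h2.
rewrite ga_scaleU ![_ * _ as X in _ = X]ga_mulUU [_ * _]ga_mulUU ga_scaleU.
by rewrite mulrCA.
Qed.

HB.instance Definition _ := GRing.Lalgebra_isAlgebra.Build R (groupAlg R G)
  ga_scaleAr.

Section Lift.
Variables (B : algType R) (phi : G -> B).

Definition ga_lift (x : A) : B := \sum_(g <- msupp x) x@_g *: phi g.

Lemma ga_liftw (d : {fset G}) x :
  msupp x `<=` d -> ga_lift x = \sum_(g <- d) x@_g *: phi g.
Proof.
move=> le; rewrite [LHS](big_fset_incl _ le) //= => g _ /mcoeff_outdom ->.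
by rewrite scale0r.
Qed.

Lemma ga_liftU c g : ga_lift << c *g g >> = c *: phi g.
Proof. by rewrite (ga_liftw msuppU_le) big_seq_fset1 mcoeffUU. Qed.

Lemma ga_lift_of g : ga_lift (ga_of R g) = phi g.
Proof. by rewrite ga_of.unlock ga_liftU scale1r. Qed.

Lemma ga_liftD : {morph ga_lift : x y / x + y}.
Proof.
move=> x y; rewrite (ga_liftw (msuppD_le x y)).
rewrite (ga_liftw (fsubsetUl _ (msupp y))) (ga_liftw (fsubsetUr (msupp x) _)).
by rewrite -big_split /=; apply: eq_bigr => g _; rewrite mcoeffD scalerDl.
Qed.

Lemma ga_liftZ a : {morph ga_lift : x / a *: x}.
Proof.
elim/ga_ind=> [c g|x y hx hy]; last by rewrite scalerDr !ga_liftD scalerDr hx hy.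
by rewrite ga_scaleU !ga_liftU scalerA.
Qed.

Hypotheses (phi1 : phi 1%g = 1) (phiM : {morph phi : x y / (x * y)%g >-> x * y}).

Lemma ga_lift1 : ga_lift 1 = 1.
Proof. by rewrite ga_lift_of. Qed.

Lemma ga_liftM : {morph ga_lift : x y / x * y}.
Proof.
move=> x y; elim/ga_ind: x => [a g|x1 x2 h1 h2]; last first.
  by rewrite mulrDl !ga_liftD mulrDl h1 h2.
elim/ga_ind: y => [b h|y1 y2 h1 h2]; last first.
  by rewrite mulrDr !ga_liftD mulrDr h1 h2.
rewrite [_ * _ in LHS]ga_mulUU !ga_liftU phiM.
by rewrite -scalerAl -scalerAr scalerA.
Qed.

End Lift.

End GroupAlgebraCom.

Section QuotientAlgebra.
Variables (R : pzRingType) (A : algType R) (S : A -> Prop).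
Implicit Types (x y z : A).

Inductive gen_ideal : A -> Prop :=
| GenIdealIn x : S x -> gen_ideal x
| GenIdeal0 : gen_ideal 0
| GenIdealD x y : gen_ideal x -> gen_ideal y -> gen_ideal (x + y)
| GenIdealMl a x : gen_ideal x -> gen_ideal (a * x)
| GenIdealMr a x : gen_ideal x -> gen_ideal (x * a).

Lemma gen_idealN x : gen_ideal x -> gen_ideal (- x).
Proof. by rewrite -mulN1r; apply: GenIdealMl. Qed.

Definition ideal_eq x y : bool := `[< gen_ideal (x - y) >].

Fact ideal_eq_refl : reflexive ideal_eq.
Proof. by move=> x; apply/asboolP; rewrite subrr; constructor. Qed.

Fact ideal_eq_sym : symmetric ideal_eq.
Proof.
by move=> x y; apply/asboolP/asboolP=> /gen_idealN; rewrite opprB.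
Qed.

Fact ideal_eq_trans : transitive ideal_eq.
Proof.
move=> y x z /asboolP xy /asboolP yz; apply/asboolP.
by rewrite -(subrKA y); apply: GenIdealD.
Qed.

Canonical ideal_equiv :=
  EquivRel ideal_eq ideal_eq_refl ideal_eq_sym ideal_eq_trans.

Definition quotAlg := {eq_quot ideal_equiv}.
HB.instance Definition _ := Choice.on quotAlg.
HB.instance Definition _ := Quotient.on quotAlg.

Implicit Types (u v : quotAlg).

Definition quot_pi (x : A) : quotAlg := \pi_quotAlg x.

Lemma quot_piP x y : quot_pi x = quot_pi y <-> gen_ideal (x - y).
Proof. by split=> [/eqmodP/asboolP|h] //; apply/eqmodP/asboolP. Qed.

Lemma quot_reprK u : quot_pi (repr u) = u.
Proof. exact: reprK. Qed.

Lemma repr_ideal x : gen_ideal (repr (quot_pi x) - x).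
Proof. by apply/quot_piP; rewrite quot_reprK. Qed.

Lemma quot_ind (P : quotAlg -> Prop) :
  (forall x, P (quot_pi x)) -> forall u, P u.
Proof. by move=> Px u; rewrite -[u]quot_reprK. Qed.

Definition quot_opp u := quot_pi (- repr u).
Definition quot_add u v := quot_pi (repr u + repr v).
Definition quot_mul u v := quot_pi (repr u * repr v).
Definition quot_scale (a : R) u := quot_pi (a *: repr u).

Lemma quot_oppE x : quot_opp (quot_pi x) = quot_pi (- x).
Proof. by apply/quot_piP; rewrite -opprD; apply/gen_idealN/repr_ideal. Qed.

Lemma quot_addE x y : quot_add (quot_pi x) (quot_pi y) = quot_pi (x + y).
Proof.
by apply/quot_piP; rewrite opprD addrACA; apply: GenIdealD; apply: repr_ideal.
Qed.

Lemma quot_mulE x y : quot_mul (quot_pi x) (quot_pi y) = quot_pi (x * y).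
Proof.
apply/quot_piP; rewrite -(subrKA (x * repr (quot_pi y))) -mulrBl -mulrBr.
by apply: GenIdealD; [apply: GenIdealMr|apply: GenIdealMl]; apply: repr_ideal.
Qed.

Lemma quot_scaleE a x : quot_scale a (quot_pi x) = quot_pi (a *: x).
Proof.
apply/quot_piP; rewrite -scalerBr -[_ - _]mul1r scalerAl.
exact/GenIdealMl/repr_ideal.
Qed.

Fact quot_addA : associative quot_add.
Proof.
elim/quot_ind=> x; elim/quot_ind=> y; elim/quot_ind=> z.
by rewrite !quot_addE addrA.
Qed.

Fact quot_addC : commutative quot_add.
Proof.
by elim/quot_ind=> x; elim/quot_ind=> y; rewrite !quot_addE addrC.
Qed.

Fact quot_add0 : left_id (quot_pi 0) quot_add.
Proof. by elim/quot_ind=> x; rewrite quot_addE add0r. Qed.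

Fact quot_addN : left_inverse (quot_pi 0) quot_opp quot_add.
Proof. by elim/quot_ind=> x; rewrite quot_oppE quot_addE addNr. Qed.

HB.instance Definition _ :=
  GRing.isZmodule.Build quotAlg quot_addA quot_addC quot_add0 quot_addN.

Fact quot_mulA : associative quot_mul.
Proof.
elim/quot_ind=> x; elim/quot_ind=> y; elim/quot_ind=> z.
by rewrite !quot_mulE mulrA.
Qed.

Fact quot_mul1 : left_id (quot_pi 1) quot_mul.
Proof. by elim/quot_ind=> x; rewrite quot_mulE mul1r. Qed.

Fact quot_mulr1 : right_id (quot_pi 1) quot_mul.
Proof. by elim/quot_ind=> x; rewrite quot_mulE mulr1. Qed.

Fact quot_mulDl : left_distributive quot_mul +%R.
Proof.
elim/quot_ind=> x; elim/quot_ind=> y; elim/quot_ind=> z.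
by rewrite [_ + _]quot_addE !quot_mulE [RHS]quot_addE mulrDl.
Qed.

Fact quot_mulDr : right_distributive quot_mul +%R.
Proof.
elim/quot_ind=> x; elim/quot_ind=> y; elim/quot_ind=> z.
by rewrite [_ + _]quot_addE !quot_mulE [RHS]quot_addE mulrDr.
Qed.

HB.instance Definition _ := GRing.Zmodule_isPzRing.Build quotAlg
  quot_mulA quot_mul1 quot_mulr1 quot_mulDl quot_mulDr.

Fact quot_scaleA a b u : quot_scale a (quot_scale b u) = quot_scale (a * b) u.
Proof. by elim/quot_ind: u => x; rewrite !quot_scaleE scalerA. Qed.

Fact quot_scale1 : left_id 1 quot_scale.
Proof. by elim/quot_ind=> x; rewrite quot_scaleE scale1r. Qed.

Fact quot_scaleDr : right_distributive quot_scale +%R.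
Proof.
move=> a; elim/quot_ind=> x; elim/quot_ind=> y.
by rewrite [_ + _]quot_addE !quot_scaleE [RHS]quot_addE scalerDr.
Qed.

Fact quot_scaleDl u : {morph quot_scale^~ u : a b / a + b}.
Proof.
move=> a b; elim/quot_ind: u => x.
by rewrite !quot_scaleE [RHS]quot_addE scalerDl.
Qed.

HB.instance Definition _ := GRing.Zmodule_isLmodule.Build R quotAlg
  quot_scaleA quot_scale1 quot_scaleDr quot_scaleDl.

Let quot_piM x y : quot_pi x * quot_pi y = quot_pi (x * y) := quot_mulE x y.
Let quot_piZ a x : a *: quot_pi x = quot_pi (a *: x) := quot_scaleE a x.

Fact quot_scaleAl a u v : a *: (u * v) = (a *: u) * v.
Proof.
elim/quot_ind: u => x; elim/quot_ind: v => y.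
by rewrite quot_piM !quot_piZ quot_piM scalerAl.
Qed.

Fact quot_scaleAr a u v : a *: (u * v) = u * (a *: v).
Proof.
elim/quot_ind: u => x; elim/quot_ind: v => y.
by rewrite quot_piM !quot_piZ quot_piM scalerAr.
Qed.

Fact quot_pi_zmod : zmod_morphism quot_pi.
Proof. by move=> x y; rewrite -quot_addE -quot_oppE. Qed.

Fact quot_pi_monoid : monoid_morphism quot_pi.
Proof. by split=> // x y; rewrite -quot_mulE. Qed.

Fact quot_pi_scalable : scalable quot_pi.
Proof. by move=> a x; rewrite -quot_scaleE. Qed.

HB.instance Definition _ := GRing.isZmodMorphism.Build A quotAlg quot_pi
  quot_pi_zmod.
HB.instance Definition _ := GRing.isMonoidMorphism.Build A quotAlg quot_pi
  quot_pi_monoid.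
HB.instance Definition _ := GRing.isScalable.Build R A quotAlg *:%R quot_pi
  quot_pi_scalable.

Definition quot_lift (B : Type) (f : A -> B) (u : quotAlg) : B := f (repr u).

Section Lift.
Variables (B : pzRingType) (f : {rmorphism A -> B}).

Hypothesis f0 : forall x, S x -> f x = 0.

Lemma gen_ideal_ker x : gen_ideal x -> f x = 0.
Proof.
elim=> {x} [x /f0||x y _ fx _ fy|a x _ fx|a x _ fx] //.
- exact: rmorph0.
- by rewrite rmorphD fx fy addr0.
- by rewrite rmorphM fx mulr0.
- by rewrite rmorphM fx mul0r.
Qed.

Lemma quot_liftE x : quot_lift f (quot_pi x) = f x.
Proof. by apply/subr0_eq; rewrite -rmorphB; apply/gen_ideal_ker/repr_ideal. Qed.

Lemma quot_liftB : zmod_morphism (quot_lift f).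
Proof.
elim/quot_ind=> x; elim/quot_ind=> y.
by rewrite -rmorphB !quot_liftE rmorphB.
Qed.

Lemma quot_liftM : monoid_morphism (quot_lift f).
Proof.
split=> [|]; first by rewrite -(rmorph1 quot_pi) quot_liftE rmorph1.
elim/quot_ind=> x; elim/quot_ind=> y.
by rewrite -rmorphM !quot_liftE rmorphM.
Qed.

End Lift.

End QuotientAlgebra.

Section ClassicalUnits.
Variable A : nzRingType.

Definition cunit_inv_of (x y : A) := y * x = 1 /\ x * y = 1.

Definition cunit : pred A := fun x => `[< exists y, cunit_inv_of x y >].

Definition cinv (x : A) : A :=
  if pselect (exists y, cunit_inv_of x y) is left ex then projT1 (cid ex) else x.

Lemma cinvP x : x \in cunit -> cunit_inv_of x (cinv x).
Proof.
move=> /asboolP ex; rewrite /cinv; case: pselect => // ex'.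
exact: (projT2 (cid ex')).
Qed.

Fact cinv_mulVr : {in cunit, left_inverse 1 cinv *%R}.
Proof. by move=> x /cinvP[]. Qed.

Fact cinv_divrr : {in cunit, right_inverse 1 cinv *%R}.
Proof. by move=> x /cinvP[]. Qed.

Fact cinv_unitrP x y : y * x = 1 /\ x * y = 1 -> x \in cunit.
Proof. by move=> xy; apply/asboolP; exists y. Qed.

Fact cinv_out : {in [predC cunit], cinv =1 id}.
Proof.
move=> x /negP Nx; rewrite /cinv; case: pselect => // ex.
by case: Nx; apply/asboolP.
Qed.

End ClassicalUnits.

(* Laurent monomials in q, u_1, u_2, ...: the free abelian group on variables
   indexed by nat, an element being its finitely supported family of
   exponents. *)
Definition lmonom := {malg int[nat]}.
HB.instance Definition _ := Choice.on lmonom.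
HB.instance Definition _ := isGroup.Build lmonom
  (@addrA {malg int[nat]}) (@add0r {malg int[nat]}) (@addr0 {malg int[nat]})
  (@addNr {malg int[nat]}) (@addrN {malg int[nat]}).

Lemma lmonom_mulC (a b : lmonom) : (a * b)%g = (b * a)%g.
Proof. exact: (@addrC {malg int[nat]}). Qed.

Definition lvar (i : nat) : lmonom := << i >>.

(* Z[q^(+-1), u_1^(+-1), u_2^(+-1), ...] *)
Definition laurent := groupAlg int lmonom.
HB.instance Definition _ := GRing.NzRing.on laurent.

Fact laurent_mulC : @commutative laurent laurent *%R.
Proof.
move=> x y; elim/ga_ind: x => [a g|x1 x2 h1 h2]; last first.
  by rewrite mulrDl mulrDr h1 h2.
elim/ga_ind: y => [b h|y1 y2 h1 h2]; last first.
  by rewrite mulrDr mulrDl h1 h2.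
by rewrite [LHS]ga_mulUU [RHS]ga_mulUU mulrC lmonom_mulC.
Qed.

HB.instance Definition _ :=
  GRing.PzRing_hasCommutativeMul.Build laurent laurent_mulC.

Definition qL : laurent := ga_of int (lvar 0).
(* [uL j] is u_j for 0 < j; the variable of index 0 is q. *)
Definition uL (j : nat) : laurent := ga_of int (lvar j).

(* The generators of B_{1,m} are indexed by 'I_m: index 0 is t, and an index
   i with 0 < i < m is sigma_i. *)
Inductive braid_rel (m : nat) : word 'I_m -> word 'I_m -> Prop :=
| BraidFour (t s1 : 'I_m) : t = 0%N :> nat -> s1 = 1%N :> nat ->
    braid_rel [:: (s1, false); (t, false); (s1, false); (t, false)]
              [:: (t, false); (s1, false); (t, false); (s1, false)]
| BraidComT (t s : 'I_m) : t = 0%N :> nat -> (1 < s)%N ->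
    braid_rel [:: (t, false); (s, false)] [:: (s, false); (t, false)]
| BraidCom (s s' : 'I_m) : (0 < s)%N -> (0 < s')%N ->
    (s.+1 < s')%N || (s'.+1 < s)%N ->
    braid_rel [:: (s, false); (s', false)] [:: (s', false); (s, false)]
| BraidThree (s s' : 'I_m) : (0 < s)%N -> s' = s.+1 :> nat ->
    braid_rel [:: (s, false); (s', false); (s, false)]
              [:: (s', false); (s, false); (s', false)].

Definition braidB (m : nat) := presGroup (@braid_rel m).
HB.instance Definition _ m := Group.on (braidB m).

(* Out-of-range indices give the unit. *)
Definition braid_gen (m i : nat) : braidB m :=
  if insub i is Some x then pres_gen (@braid_rel m) x else 1%g.

Lemma braid_genE m (x : 'I_m) : braid_gen m x = pres_gen (@braid_rel m) x.
Proof. by rewrite /braid_gen valK. Qed.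

Definition braid_incl (m : nat) : braidB m -> braidB m.+1 :=
  pres_lift (fun x : 'I_m => braid_gen m.+1 x).

Lemma word_eval_pres (X : choiceType) (rl : word X -> word X -> Prop) w :
  word_eval (pres_gen rl) w = \pi_(presGroup rl) w.
Proof.
elim: w => [|[x b] w IHw]; first by rewrite /word_eval big_nil.
rewrite /word_eval big_cons -/(word_eval _ w) IHw /letter_eval /=.
rewrite -[RHS](pres_mulE rl [:: (x, b)] w); congr (_ * _)%g.
case: b => //; apply: (@mulgI _ (pres_gen rl x)); rewrite mulgV.
rewrite [RHS](pres_mulE rl [:: (x, false)] [:: (x, true)]); apply/esym/pres_eqP.
exact: (@WordCancel _ rl [::] [::] x false).
Qed.

Lemma braid_rel_eval (m : nat) (H : groupType) (f : nat -> H) :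
  ((1 < m)%N -> (f 1%N * f 0%N * f 1%N * f 0%N = f 0%N * f 1%N * f 0%N * f 1%N)%g) ->
  (forall i, (1 < i < m)%N -> (f 0%N * f i = f i * f 0%N)%g) ->
  (forall i j, (0 < i < m)%N -> (0 < j < m)%N -> (i.+1 < j)%N || (j.+1 < i)%N ->
     (f i * f j = f j * f i)%g) ->
  (forall i, (0 < i)%N -> (i.+1 < m)%N ->
     (f i * f i.+1 * f i = f i.+1 * f i * f i.+1)%g) ->
  forall l r, @braid_rel m l r ->
    word_eval (fun x : 'I_m => f x) l = word_eval (fun x : 'I_m => f x) r.
Proof.
move=> h4 hT hC h3 l r.
case=> {l r} [t s t0 s1|t s t0 s1|s s' s0 s'0 ss'|s s' s0 ss'];
  rewrite /word_eval !big_cons big_nil /letter_eval /= !mulg1 ?mulgA.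
- by rewrite t0 s1 h4 // -s1.
- by rewrite t0 hT // s1 /=.
- by rewrite hC // ?s0 ?s'0 /=.
- by rewrite ss' h3 // -ss'.
Qed.

Lemma braid_gen_rel (m : nat) (l r : word 'I_m) : braid_rel l r ->
  word_eval (fun x : 'I_m => braid_gen m x) l
  = word_eval (fun x : 'I_m => braid_gen m x) r.
Proof.
move=> lr; have e w : word_eval (fun x : 'I_m => braid_gen m x) w =
    word_eval (pres_gen (@braid_rel m)) w.
  by apply: eq_bigr => -[x b] _; rewrite /letter_eval /= braid_genE.
rewrite !e !word_eval_pres; apply/pres_eqP.
by have := @WordRel _ _ [::] [::] _ _ lr; rewrite /= !cats0.
Qed.

Lemma braid_incl_rel (m : nat) (l r : word 'I_m) : braid_rel l r ->
  word_eval (fun x : 'I_m => braid_gen m.+1 x) l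
  = word_eval (fun x : 'I_m => braid_gen m.+1 x) r.
Proof.
pose wd (w : word 'I_m) := [seq (widen_ord (leqnSn m) p.1, p.2) | p <- w].
have e w : word_eval (fun x : 'I_m => braid_gen m.+1 x) w =
    word_eval (fun x : 'I_m.+1 => braid_gen m.+1 x) (wd w).
  by rewrite /word_eval big_map; apply: eq_bigr.
move=> lr; rewrite !e; apply: braid_gen_rel.
by case: lr => {l r} *; [apply: BraidFour|apply: BraidComT|apply: BraidCom|apply: BraidThree].
Qed.

Lemma braid_incl_gen (m i : nat) : (i < m)%N ->
  braid_incl (braid_gen m i) = braid_gen m.+1 i.
Proof.
move=> im; rewrite -[i]/(val (Ordinal im)) braid_genE /braid_incl.
by rewrite (pres_lift_gen (@braid_incl_rel m)).
Qed.

Lemma braid_incl1 (m : nat) : @braid_incl m 1%g = 1%g.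
Proof. exact: pres_lift1 (@braid_incl_rel m). Qed.

Lemma braid_inclM (m : nat) : {morph @braid_incl m : x y / (x * y)%g}.
Proof. exact: pres_liftM (@braid_incl_rel m). Qed.

Lemma braid_inclV (m : nat) : {morph @braid_incl m : x / (x^-1)%g}.
Proof.
move=> x; apply: (@mulgI _ (braid_incl x)).
by rewrite -braid_inclM !mulgV braid_incl1.
Qed.

(* [Infinite] selects H_m(q,oo) and [Cyclotomic d _] selects H_m(q,d). *)
Variant level := Infinite | Cyclotomic (d : nat) of (0 < d)%N.

Section HeckeGeneric.
Variables (R : comNzRingType) (q : R) (u : nat -> R) (p : level) (m : nat).

Local Notation RB := (groupAlg R (braidB m)).

Definition braid_el (i : nat) : RB := ga_of R (braid_gen m i).

(* An element x of this set stands for the relation x = 0; t is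
   [braid_el 0], which is meaningful for 0 < m only. *)
Inductive hecke_rel : RB -> Prop :=
| HeckeQuadratic (i : nat) : (0 < i < m)%N ->
    hecke_rel (braid_el i ^+ 2 - ((q - 1) *: braid_el i + q%:A))
| HeckeCyclotomic (d : nat) (d0 : (0 < d)%N) :
    (0 < m)%N -> p = Cyclotomic d0 ->
    hecke_rel (\prod_(1 <= j < d.+1) (braid_el 0 - (u j)%:A)).

Definition heckeOver := quotAlg hecke_rel.

HB.instance Definition _ := GRing.PzRing.on heckeOver.
HB.instance Definition _ := GRing.Lmodule.on heckeOver.

Let quot_pi_alg a : quot_pi hecke_rel a%:A = a *: (1 : quotAlg hecke_rel).
Proof. exact: quot_pi_scalable. Qed.

Lemma heckeOver_quadratic i : (0 < i < m)%N ->
  quot_pi hecke_rel (braid_el i) ^+ 2 =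
  (q - 1) *: quot_pi hecke_rel (braid_el i) + q *: (1 : quotAlg hecke_rel).
Proof.
move=> im; rewrite -quot_pi_alg -quot_pi_scalable -rmorphXn -rmorphD.
by apply/quot_piP/GenIdealIn/HeckeQuadratic.
Qed.

Lemma heckeOver_cyclotomic d (d0 : (0 < d)%N) :
  (0 < m)%N -> p = Cyclotomic d0 ->
  \prod_(1 <= j < d.+1) (quot_pi hecke_rel (braid_el 0) - u j *: (1 : quotAlg hecke_rel)) = 0.
Proof.
move=> m0 pE; have h := GenIdealIn (HeckeCyclotomic m0 pE).
rewrite -[X in gen_ideal _ X]subr0 in h; move/quot_piP: h => h.
rewrite -[RHS](rmorph0 (quot_pi hecke_rel)) -[RHS]h.
rewrite rmorph_prod; apply: eq_bigr => j _.
by rewrite rmorphB /= quot_pi_alg.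
Qed.

Section Lift.
Variables (B : algType R) (phi : braidB m -> B).
Hypotheses (phi1 : phi 1%g = 1) (phiM : {morph phi : x y / (x * y)%g >-> x * y}).
Hypothesis phiQ : forall i, (0 < i < m)%N ->
  phi (braid_gen m i) ^+ 2 = (q - 1) *: phi (braid_gen m i) + q%:A.
Hypothesis phiC : forall d (d0 : (0 < d)%N), (0 < m)%N -> p = Cyclotomic d0 ->
  \prod_(1 <= j < d.+1) (phi (braid_gen m 0) - (u j)%:A) = 0.

Definition ring_phi : RB -> B := ga_lift phi.

Fact ring_phi_zmod : zmod_morphism ring_phi.
Proof.
move=> x y; rewrite /ring_phi -scaleN1r (ga_liftD _ x) ga_liftZ.
by rewrite scaleN1r.
Qed.

Fact ring_phi_monoid : monoid_morphism ring_phi.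
Proof. by split; [apply: ga_lift1 | apply: ga_liftM]. Qed.

HB.instance Definition _ :=
  GRing.isZmodMorphism.Build RB B ring_phi ring_phi_zmod.
HB.instance Definition _ :=
  GRing.isMonoidMorphism.Build RB B ring_phi ring_phi_monoid.

Lemma ring_phi_rel x : hecke_rel x -> ring_phi x = 0.
Proof.
have phiZ a y : ring_phi (a *: y) = a *: ring_phi y by apply: ga_liftZ.
have phiA a : ring_phi a%:A = a%:A by rewrite phiZ rmorph1.
have phig i : ring_phi (braid_el i) = phi (braid_gen m i) by apply: ga_lift_of.
case=> [i im|d d0 m0 pE].
  by rewrite rmorphB rmorphXn rmorphD /= phiZ phiA phig phiQ // subrr.
rewrite rmorph_prod -[RHS](phiC m0 pE); apply: eq_bigr => j _.
by rewrite rmorphB /= phiA phig.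
Qed.

Definition hecke_lift : heckeOver -> B := quot_lift ring_phi.

Lemma hecke_lift_pi x : hecke_lift (quot_pi _ x) = ring_phi x.
Proof. exact: quot_liftE ring_phi_rel x. Qed.

Lemma hecke_lift_zmod : zmod_morphism hecke_lift.
Proof. exact: quot_liftB ring_phi_rel. Qed.

Lemma hecke_lift_monoid : monoid_morphism hecke_lift.
Proof. exact: quot_liftM ring_phi_rel. Qed.

Lemma hecke_lift_scalable : scalable hecke_lift.
Proof.
move=> a; elim/quot_ind=> x; rewrite hecke_lift_pi.
have -> : a *: quot_pi hecke_rel x = quot_pi hecke_rel (a *: x).
  by rewrite quot_pi_scalable.
by rewrite hecke_lift_pi; apply: ga_liftZ.
Qed.

Lemma hecke_lift_nz : 1 != 0 :> heckeOver.
Proof.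
apply/eqP => e; have := congr1 hecke_lift e.
rewrite hecke_lift_monoid.1 -(subrr 0) hecke_lift_zmod subrr => /eqP.
by rewrite oner_eq0.
Qed.

End Lift.

End HeckeGeneric.

Fact regular_quadratic (R : comNzRingType) (z : R) :
  (z : R^o) ^+ 2 = (z - 1) *: (z : R^o) + z%:A.
Proof. by rewrite /GRing.scale /= mulrBl mul1r mulr1 subrK expr2. Qed.

Fact regular_cyclotomic (R : comNzRingType) (v : nat -> R) d : (0 < d)%N ->
  \prod_(1 <= j < d.+1) ((v 1 : R^o) - (v j)%:A) = 0.
Proof.
by move=> d0; rewrite big_nat_recl // /GRing.scale /= mulr1 subrr mul0r.
Qed.

Section HeckeAlgebra.
Variables (p : level) (m : nat).

Definition hecke := heckeOver qL uL p m.

HB.instance Definition _ := GRing.PzRing.on hecke.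
HB.instance Definition _ := GRing.Lmodule.on hecke.

(* Nontriviality, from the character t |-> u_1, sigma_i |-> q. *)
Let lchar (i : nat) : lmonom := lvar (i == 0%N).

Let lcharP (l r : word 'I_m) : braid_rel l r ->
  word_eval (fun x : 'I_m => lchar x) l = word_eval (fun x : 'I_m => lchar x) r.
Proof.
apply: (@braid_rel_eval m _ lchar) => [_|i _|i j _ _ _|[|i] // _ _].
- by rewrite (lmonom_mulC _ (lchar 0)) !mulgA.
- exact: lmonom_mulC.
- exact: lmonom_mulC.
Qed.

Let bchar : braidB m -> lmonom := pres_lift (fun x : 'I_m => lchar x).

Let bchar_gen i : (i < m)%N -> bchar (braid_gen m i) = lchar i.
Proof.
move=> im; rewrite /bchar -[i]/(val (Ordinal im)) braid_genE.
exact: (pres_lift_gen lcharP).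
Qed.

Let phi (g : braidB m) : laurent^o := ga_of int (bchar g).

Fact hecke_one_neq0 : 1 != 0 :> hecke.
Proof.
apply: (@hecke_lift_nz _ qL uL p m laurent^o phi).
- by rewrite /phi /bchar (pres_lift1 lcharP) ga_of1.
- by move=> x y; rewrite /phi /bchar (pres_liftM lcharP) ga_ofM.
- move=> i /andP[i0 im]; rewrite /phi (bchar_gen im) /lchar gtn_eqF //.
  exact: regular_quadratic.
- move=> d d0 m0 _; rewrite /phi (bchar_gen m0); exact: regular_cyclotomic.
Qed.

HB.instance Definition _ := GRing.PzSemiRing_isNonZero.Build hecke hecke_one_neq0.

Fact hecke_scaleAl (a : laurent) (x y : hecke) : a *: (x * y) = (a *: x) * y.
Proof. exact: quot_scaleAl. Qed.

HB.instance Definition _ := GRing.Lmodule_isLalgebra.Build laurent hecke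
  hecke_scaleAl.

Fact hecke_scaleAr (a : laurent) (x y : hecke) : a *: (x * y) = x * (a *: y).
Proof. exact: quot_scaleAr. Qed.

HB.instance Definition _ := GRing.Lalgebra_isAlgebra.Build laurent hecke
  hecke_scaleAr.

HB.instance Definition _ := GRing.NzRing_hasMulInverse.Build hecke
  (@cinv_mulVr hecke) (@cinv_divrr hecke) (@cinv_unitrP hecke) (@cinv_out hecke).

Definition hecke_pi : groupAlg laurent (braidB m) -> hecke := @quot_pi _ _ _.
HB.instance Definition _ := GRing.RMorphism.on hecke_pi.

Definition braid_img (b : braidB m) : hecke := hecke_pi (ga_of laurent b).

Lemma braid_img1 : braid_img 1%g = 1.
Proof. by rewrite /braid_img ga_of1 rmorph1. Qed.

Lemma braid_imgM : {morph braid_img : a b / (a * b)%g >-> a * b}.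
Proof. by move=> a b; rewrite /braid_img ga_ofM rmorphM. Qed.

Lemma braid_img_unit b : braid_img b \is a GRing.unit.
Proof.
by apply/unitrP; exists (braid_img b^-1%g);
  rewrite -!braid_imgM mulVg mulgV braid_img1.
Qed.

Lemma braid_imgV b : braid_img b^-1%g = (braid_img b)^-1.
Proof.
apply: (mulrI (braid_img_unit b)).
by rewrite -braid_imgM mulgV braid_img1 divrr // braid_img_unit.
Qed.

Definition tH : hecke := braid_img (braid_gen m 0).
Definition gH (i : nat) : hecke := braid_img (braid_gen m i).

(* g_i ... g_1 t g_1^-1 ... g_i^-1; equal to t for i = 0. *)
Definition tprime (i : nat) : hecke :=
  (\prod_(j <- rev (index_iota 1 i.+1)) gH j) * tH *
  (\prod_(1 <= j < i.+1) (gH j)^-1).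

End HeckeAlgebra.

Section HeckeInclusion.
Variables (p : level) (m : nat).

Let phi (b : braidB m) : hecke p m.+1 := braid_img p (braid_incl b).

Let phi1 : phi 1%g = 1.
Proof. by rewrite /phi braid_incl1 braid_img1. Qed.

Let phiM : {morph phi : x y / (x * y)%g >-> x * y}.
Proof. by move=> x y; rewrite /phi braid_inclM braid_imgM. Qed.

Let phiQ i : (0 < i < m)%N ->
  phi (braid_gen m i) ^+ 2 = (qL - 1) *: phi (braid_gen m i) + qL%:A.
Proof.
move=> /andP[i0 im]; rewrite /phi (braid_incl_gen im).
by apply: heckeOver_quadratic; rewrite i0 ltnW.
Qed.

Let phiC d (d0 : (0 < d)%N) : (0 < m)%N -> p = Cyclotomic d0 ->
  \prod_(1 <= j < d.+1) (phi (braid_gen m 0) - (uL j)%:A) = 0.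
Proof.
move=> m0 pE; rewrite /phi (braid_incl_gen m0).
exact: (heckeOver_cyclotomic qL uL (ltn0Sn m) pE).
Qed.

Definition hecke_incl : hecke p m -> hecke p m.+1 := hecke_lift phi.

Fact hecke_incl_zmod : zmod_morphism hecke_incl.
Proof. exact: hecke_lift_zmod phi1 phiM phiQ phiC. Qed.

Fact hecke_incl_monoid : monoid_morphism hecke_incl.
Proof. exact: hecke_lift_monoid phi1 phiM phiQ phiC. Qed.

Fact hecke_incl_scalable : scalable hecke_incl.
Proof. exact: hecke_lift_scalable phi1 phiM phiQ phiC. Qed.

HB.instance Definition _ := GRing.isZmodMorphism.Build
  (hecke p m) (hecke p m.+1) hecke_incl hecke_incl_zmod.
HB.instance Definition _ := GRing.isMonoidMorphism.Build
  (hecke p m) (hecke p m.+1) hecke_incl hecke_incl_monoid.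
HB.instance Definition _ := GRing.isScalable.Build laurent
  (hecke p m) (hecke p m.+1) *:%R hecke_incl hecke_incl_scalable.

Lemma hecke_incl_img (b : braidB m) :
  hecke_incl (braid_img p b) = braid_img p (braid_incl b).
Proof.
rewrite /hecke_incl /braid_img /hecke_pi.
rewrite (hecke_lift_pi phi1 phiM phiQ phiC).
exact: ga_lift_of.
Qed.

End HeckeInclusion.

Arguments hecke_incl : clear implicits.

(* The set Z of exponents: all integers, or 0, ..., d-1. *)
Definition exponent (p : level) : pred int :=
  if p is @Cyclotomic d _ then [pred k | 0 <= k < d%:Z] else predT.

(* The four types of words, stripped of their left factor in H_n; see
   [basis_elt]. *)
Variant basis_word :=
| Word1
| Word2 (i : nat)
| Word3 (i : nat) (k : int)
| Word4 (k : int).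

Definition basis_word_encode (w : basis_word) : unit + nat + nat * int + int :=
  match w with
  | Word1 => inl (inl (inl tt))
  | Word2 i => inl (inl (inr i))
  | Word3 i k => inl (inr (i, k))
  | Word4 k => inr k
  end.

Definition basis_word_decode (c : unit + nat + nat * int + int) : basis_word :=
  match c with
  | inl (inl (inl _)) => Word1
  | inl (inl (inr i)) => Word2 i
  | inl (inr (i, k)) => Word3 i k
  | inr k => Word4 k
  end.

Lemma basis_word_encodeK : cancel basis_word_encode basis_word_decode.
Proof. by case. Qed.

HB.instance Definition _ := Countable.copy basis_word (can_type basis_word_encodeK).

Definition admissible (p : level) (n : nat) (w : basis_word) : bool :=
  match w with
  | Word1 => true
  | Word2 i => (1 <= i <= n)%N
  | Word3 i k => [&& (i <= n.-1)%N, k \in exponent p & k != 0]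
  | Word4 k => (k \in exponent p) && (k != 0)
  end.

Definition basis_index (p : level) (n : nat) := {w : basis_word | admissible p n w}.

Section BasisElements.
Variables (p : level) (n : nat).

(* g_n g_{n-1} ... g_i, which is 1 for i = n+1. *)
Definition gdesc (i : nat) : hecke p n.+1 :=
  \prod_(j <- rev (index_iota i n.+1)) gH p n.+1 j.

Definition basis_elt (w : basis_word) : hecke p n.+1 :=
  match w with
  | Word1 => 1
  | Word2 i => gdesc i
  | Word3 i k => gdesc i.+1 * tprime p n.+1 i ^ k
  | Word4 k => tprime p n.+1 n ^ k
  end.

End BasisElements.

(* e is a basis of B as a left A-module, A acting on B through f. Taking the
   coefficients in A, not in f(A), forces f to be injective when I is
   nonempty. *)
Definition left_basis (A B : pzRingType) (f : {rmorphism A -> B}) (I : choiceType)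
    (e : I -> B) : Prop :=
  forall x : B, exists! c : {fsfun I -> A with 0},
    x = \sum_(i <- finsupp c) f (c i) * e i.

(* Main.v *)
(* Put b(i,k) = g_n...g_1 t^k g_1^-1...g_i^-1, for 0 <= i <= n and k in Z; the
   words of the theorem, without their left factors, are these elements. The
   braid relations give
     b(i,k) g_j = g_(j-1) b(i,k) (j > i+1),  (q-1) b(i,k) + q b(i+1,k) (j = i+1),
                  b(i-1,k) (j = i),          g_j b(i,k) (j < i),
   and b(0,k) t = b(0,k+1), and, with P_i = g_1^-1...g_(i-1)^-1, for i > 0,
     b(i,k) t = t b(i,k) + (1 - q^-1) (t^k P_i b(0,1) - P_i b(0,k+1)),
   which rests on the Bernstein-type identity
     g_1 t^k g_1^-1 t = t g_1 t^k g_1^-1 + (q-1) (t^k g_1^-1 t - g_1^-1 t^(k+1)).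
   Hence the left H_n-span of the b(i,k) is stable under right multiplication.

   For independence, the transposes of these formulas are operators on the
   families F(i,k) with values in H_n (in the cyclotomic case, on those that
   satisfy in k the linear recurrence with characteristic polynomial
   (X - u_1)...(X - u_d)). They satisfy the relations of H_(n+1), which
   therefore acts on such families. The functional x |-> (x F)(n,0) is left
   H_n-linear and takes the value F(i,k) at b(i,k); letting F be a delta family
   gives the coordinate functions. *)

From HB Require Import structures.
Require Import Defs.
From mathcomp Require Import all_boot all_algebra finmap.
From mathcomp Require Import boolp functions ring zify.

Set Implicit Arguments.
Unset Strict Implicit.
Unset Printing Implicit Defensive.

Import GRing.Theory.

Local Open Scope ring_scope.
Local Open Scope quotient_scope.

(** * Identities in noncommutative algebras *)

Section NcAlg.
Variables (R : comNzRingType) (A : algType R).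

(** Syntax for proof by reflection: [nc_reduce] reifies an equation, [nc_norm] expands the
    difference of its sides and collects equal words in the atoms, and only the vanishing of the
    coefficients is left to [ring]. *)
Inductive ncexp :=
  NcAtom of nat | NcOne | NcZero | NcAdd of ncexp & ncexp | NcOpp of ncexp
| NcMul of ncexp & ncexp | NcScale of R & ncexp.

Fixpoint nc_eval (env : seq A) e : A :=
  match e with
  | NcAtom i => nth 0 env i
  | NcOne => 1
  | NcZero => 0
  | NcAdd e1 e2 => nc_eval env e1 + nc_eval env e2
  | NcOpp e1 => - nc_eval env e1
  | NcMul e1 e2 => nc_eval env e1 * nc_eval env e2
  | NcScale a e1 => a *: nc_eval env e1
  end.

(** These versions of equality and concatenation can be named in the [cbv] of [nc_reduce], which
    computes on words while leaving the operations of [R] folded for [ring]. *)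
Fixpoint nc_eqn (i j : nat) : bool :=
  match i, j with 0%N, 0%N => true | i'.+1, j'.+1 => nc_eqn i' j' | _, _ => false end.

Fixpoint nc_eqw (v w : seq nat) : bool :=
  match v, w with
  | [::], [::] => true
  | i :: v', j :: w' => if nc_eqn i j then nc_eqw v' w' else false
  | _, _ => false
  end.

Fixpoint nc_app (v w : seq nat) : seq nat := if v is i :: v' then i :: nc_app v' w else w.

(* A noncommutative polynomial is a list of pairs (coefficient, monomial). *)
Fixpoint nc_ins (a : R) (w : seq nat) (l : seq (R * seq nat)) :=
  match l with
  | [::] => [:: (a, w)]
  | (b, v) :: l' => if nc_eqw w v then (b + a, v) :: l' else (b, v) :: nc_ins a w l'
  end.

Fixpoint nc_addp (k l : seq (R * seq nat)) :=
  if k is (a, w) :: k' then nc_addp k' (nc_ins a w l) else l.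

Fixpoint nc_mulm (a : R) (w : seq nat) (l : seq (R * seq nat)) :=
  if l is (b, v) :: l' then (a * b, nc_app w v) :: nc_mulm a w l' else [::].

Fixpoint nc_mulp (k l : seq (R * seq nat)) :=
  if k is (a, w) :: k' then nc_addp (nc_mulm a w l) (nc_mulp k' l) else [::].

Fixpoint nc_norm e : seq (R * seq nat) :=
  match e with
  | NcAtom i => [:: (1, [:: i])]
  | NcOne => [:: (1, [::])]
  | NcZero => [::]
  | NcAdd e1 e2 => nc_addp (nc_norm e1) (nc_norm e2)
  | NcOpp e1 => nc_mulm (- 1) [::] (nc_norm e1)
  | NcMul e1 e2 => nc_mulp (nc_norm e1) (nc_norm e2)
  | NcScale a e1 => nc_mulm a [::] (nc_norm e1)
  end.

Fixpoint nc_vanish (l : seq (R * seq nat)) : Prop :=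
  if l is (a, _) :: l' then a = 0 /\ nc_vanish l' else True.

Variable env : seq A.
Let mon w : A := \prod_(i <- w) nth 0 env i.
Let den (l : seq (R * seq nat)) : A := \sum_(p <- l) p.1 *: mon p.2.

Let eqnP i j : nc_eqn i j -> i = j.
Proof. by elim: i j => [|i IHi] [|j] //= /IHi ->. Qed.

Let eqwP v w : nc_eqw v w -> v = w.
Proof.
elim: v w => [|i v IHv] [|j w] //=; case e: nc_eqn => // /IHv ->.
by rewrite (eqnP e).
Qed.

Let appE v w : nc_app v w = v ++ w.
Proof. by elim: v => //= i v ->. Qed.

Let den_ins a w l : den (nc_ins a w l) = a *: mon w + den l.
Proof.
rewrite /den; elim: l => [|[b v] l IHl] /=; first by rewrite big_seq1 big_nil addr0.
case e: nc_eqw; last by rewrite !big_cons IHl addrCA.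
by rewrite !big_cons (eqwP e) /= scalerDl addrCA addrA.
Qed.

Let den_addp k l : den (nc_addp k l) = den k + den l.
Proof.
elim: k l => [|[a w] k IHk] l /=; first by rewrite /den big_nil add0r.
by rewrite IHk den_ins [in RHS]/den big_cons /= addrCA addrA.
Qed.

Let den_mulm a w l : den (nc_mulm a w l) = a *: (mon w * den l).
Proof.
rewrite /den; elim: l => [|[b v] l IHl] /=; first by rewrite !big_nil mulr0 scaler0.
rewrite !big_cons IHl mulrDr scalerDr /= appE /mon big_cat /=.
by rewrite -scalerAr scalerA.
Qed.

Let den_mulp k l : den (nc_mulp k l) = den k * den l.
Proof.
elim: k => [|[a w] k IHk] /=; first by rewrite /den !big_nil mul0r.
by rewrite den_addp den_mulm IHk [in RHS]/den big_cons mulrDl /= -scalerAl.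
Qed.

Let mon0 : mon [::] = 1. Proof. exact: big_nil. Qed.

Let den_norm e : den (nc_norm e) = nc_eval env e.
Proof.
elim: e => [i||| e1 IH1 e2 IH2|e IH|e1 IH1 e2 IH2|a e IH] /=.
- by rewrite /den big_seq1 /mon big_seq1 scale1r.
- by rewrite /den big_seq1 /mon big_nil scale1r.
- by rewrite /den big_nil.
- by rewrite den_addp IH1 IH2.
- by rewrite den_mulm IH mon0 mul1r scaleN1r.
- by rewrite den_mulp IH1 IH2.
- by rewrite den_mulm IH mon0 mul1r.
Qed.

Lemma nc_correct e1 e2 :
  nc_vanish (nc_norm (NcAdd e1 (NcOpp e2))) -> nc_eval env e1 = nc_eval env e2.
Proof.
move=> h; apply/subr0_eq; rewrite -[LHS]/(nc_eval env (NcAdd e1 (NcOpp e2))) -den_norm.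
elim: (nc_norm _) h => [|[a w] l IHl] /=; first by rewrite /den big_nil.
by case=> -> /IHl; rewrite /den big_cons scale0r add0r.
Qed.
End NcAlg.

Ltac nc_mem x l :=
  lazymatch l with
  | nil => constr:(false)
  | cons x _ => constr:(true)
  | cons _ ?l' => nc_mem x l'
  end.

Ltac nc_index x l :=
  lazymatch l with
  | cons x _ => constr:(O)
  | cons _ ?l' => let i := nc_index x l' in constr:(S i)
  end.

Ltac nc_atoms x l :=
  lazymatch x with
  | GRing.add ?a ?b => let l := nc_atoms a l in nc_atoms b l
  | GRing.mul ?a ?b => let l := nc_atoms a l in nc_atoms b l
  | GRing.opp ?a => nc_atoms a l
  | GRing.scale _ ?a => nc_atoms a l
  | @GRing.one _ => l
  | @GRing.zero _ => l
  | _ => lazymatch nc_mem x l with true => l | false => constr:(cons x l) end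
  end.

Ltac nc_reify R x l :=
  lazymatch x with
  | GRing.add ?a ?b =>
      let a := nc_reify R a l in let b := nc_reify R b l in constr:(@NcAdd R a b)
  | GRing.mul ?a ?b =>
      let a := nc_reify R a l in let b := nc_reify R b l in constr:(@NcMul R a b)
  | GRing.opp ?a => let a := nc_reify R a l in constr:(@NcOpp R a)
  | GRing.scale ?c ?a => let a := nc_reify R a l in constr:(@NcScale R c a)
  | @GRing.one _ => constr:(@NcOne R)
  | @GRing.zero _ => constr:(@NcZero R)
  | _ => let i := nc_index x l in constr:(@NcAtom R i)
  end.

(* Reduces an equation in the R-algebra A to equations between coefficients in R. *)
Ltac nc_reduce R A :=
  lazymatch goal with
  | |- @eq ?T ?x ?y =>
    let l := nc_atoms x (@nil T) in let l := nc_atoms y l in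
    let ex := nc_reify R x l in let ey := nc_reify R y l in
    refine (@nc_correct R A l ex ey _);
    cbv [nc_norm nc_vanish nc_mulp nc_mulm nc_addp nc_ins nc_app nc_eqw nc_eqn]
  end.

(** * Endomorphism algebras *)

Section EndAlgebra.
Variables (R : comNzRingType) (V : lmodType R).

Definition is_endo : pred (V -> V) := fun f => `[< linear f >].
Record endo := Endo { endo_fun :> V -> V; _ : is_endo endo_fun }.

HB.instance Definition _ := [isSub for endo_fun].
HB.instance Definition _ := [Choice of endo by <:].

Fact is_endo_submod : submod_closed is_endo.
Proof.
split=> [|a f g /asboolP fl /asboolP gl]; apply/asboolP => b x y.
  by rewrite scaler0 addr0.
change (a *: f (b *: x + y) + g (b *: x + y)
  = b *: (a *: f x + g x) + (a *: f y + g y)).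
rewrite fl gl !scalerDr !scalerA (mulrC a) -!addrA.
by congr (_ + _); rewrite addrCA.
Qed.
HB.instance Definition _ := GRing.isSubmodClosed.Build R (V -> V) is_endo is_endo_submod.
HB.instance Definition _ := [SubChoice_isSubLmodule of endo by <:].

Lemma endo_linear (f : endo) : linear f.
Proof. by case: f => f /= /asboolP. Qed.

Lemma endoP (f g : endo) : f =1 g -> f = g.
Proof. by move=> fg; apply/val_inj/funext. Qed.

Definition mk_endo (f : V -> V) (fl : linear f) : endo := Endo (asboolT fl).

Fact endo_one_linear : linear (@id V). Proof. by []. Qed.
Fact endo_mul_linear (f g : endo) : linear (f \o g).
Proof. by move=> a x y /=; rewrite !endo_linear. Qed.

Definition endo_one := mk_endo endo_one_linear.
Definition endo_mul f g := mk_endo (endo_mul_linear f g).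

Variables (v : V) (v_neq0 : v != 0).

(* Mathcomp algebras are nontrivial, hence the proof of [v != 0] as a parameter. *)
Definition endo_alg & v != 0 : Type := endo.
Local Notation E := (endo_alg v_neq0).
HB.instance Definition _ := GRing.Lmodule.on E.

Fact endo_mulA : @associative E endo_mul.
Proof. by move=> f g h; apply: endoP. Qed.
Fact endo_mul1l : @left_id E E endo_one endo_mul.
Proof. by move=> f; apply: endoP. Qed.
Fact endo_mul1r : @right_id E E endo_one endo_mul.
Proof. by move=> f; apply: endoP. Qed.
Fact endo_mulDl : @left_distributive E E endo_mul +%R.
Proof. by move=> f g h; apply: endoP. Qed.
Fact endo_mulDr : @right_distributive E E endo_mul +%R.
Proof.
move=> f g h; apply: endoP => x.
by have := endo_linear f 1 (g x) (h x); rewrite !scale1r.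
Qed.
Fact endo_one_neq0 : endo_one != 0 :> E.
Proof. by apply/eqP => /(congr1 (fun f : endo => f v)) /= /eqP; apply/negP. Qed.

HB.instance Definition _ := GRing.Zmodule_isNzRing.Build E
  endo_mulA endo_mul1l endo_mul1r endo_mulDl endo_mulDr endo_one_neq0.

Fact endo_scaleAl a (f g : E) : a *: (f * g) = (a *: f) * g.
Proof. exact: endoP. Qed.
HB.instance Definition _ := GRing.Lmodule_isLalgebra.Build R E endo_scaleAl.

Fact endo_scaleAr a (f g : E) : a *: (f * g) = f * (a *: g).
Proof.
apply: endoP => x.
have f0 : (f : endo) 0 = 0.
  by have := endo_linear f (-1) 0 0; rewrite scaler0 addr0 scaleN1r addNr.
by have := endo_linear f a ((g : endo) x) 0; rewrite addr0 f0 addr0 => e; apply: esym.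
Qed.
HB.instance Definition _ := GRing.Lalgebra_isAlgebra.Build R E endo_scaleAr.

End EndAlgebra.

(** * Relations in algebras of Hecke type *)

Lemma int_step_ind (P : int -> Prop) :
  P 0 -> (forall k, P k <-> P (k + 1)) -> forall k, P k.
Proof.
move=> P0 Pstep; elim/int_ind=> // n Pn.
  by have /Pstep := Pn; rewrite -addn1 PoszD.
by apply/Pstep; rewrite -addn1 PoszD opprD subrK.
Qed.

Section HeckeRelations.
Variables (R : comNzRingType) (q qi : R) (A : unitAlgType R).

(** The relations of H_m apart from the cyclotomic one, for elements of any algebra. They serve for
    H_n, where the families take their values, and for H_(n+1), where the b(i,k) live. *)
Record hecke_system (m : nat) (t : A) (g : nat -> A) : Prop := HeckeSystem {
  hs_unit : t \is a GRing.unit;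
  hs_quad : forall i, (0 < i < m)%N -> g i * g i = (q - 1) *: g i + q%:A;
  hs_four : (1 < m)%N -> g 1%N * t * g 1%N * t = t * g 1%N * t * g 1%N;
  hs_comT : forall i, (1 < i < m)%N -> t * g i = g i * t;
  hs_com : forall i j, (0 < i)%N -> (i.+1 < j < m)%N -> g i * g j = g j * g i;
  hs_three : forall i, (0 < i)%N -> (i.+1 < m)%N ->
    g i * g i.+1 * g i = g i.+1 * g i * g i.+1 }.

Hypothesis qK : q * qi = 1.
Variables (m : nat) (t : A) (g : nat -> A).
Hypothesis hs : hecke_system m t g.

Ltac nc := nc_reduce R A; repeat split; ring: qK.

Lemma gen_mulK i : (0 < i < m)%N -> g i * (qi *: g i + (qi - 1)%:A) = 1.
Proof.
move=> im; rewrite mulrDr -!scalerAr (hs_quad hs im) mulr1.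
nc.
Qed.

Lemma gen_mulKl i : (0 < i < m)%N -> (qi *: g i + (qi - 1)%:A) * g i = 1.
Proof.
move=> im; rewrite mulrDl -!scalerAl (hs_quad hs im) mul1r.
nc.
Qed.

Lemma gen_unit i : (0 < i < m)%N -> g i \is a GRing.unit.
Proof.
by move=> im; apply/unitrP; exists (qi *: g i + (qi - 1)%:A); rewrite gen_mulK ?gen_mulKl.
Qed.

Lemma gen_inv i : (0 < i < m)%N -> (g i)^-1 = qi *: g i + (qi - 1)%:A.
Proof. by move=> im; apply: (mulrI (gen_unit im)); rewrite gen_mulK // divrr // gen_unit. Qed.

Lemma gen_inv_lin i : (0 < i < m)%N -> g i = (q - 1)%:A + q *: (g i)^-1.
Proof. move=> im; rewrite gen_inv //; nc. Qed.

Lemma gen_comm i j : (0 < i < m)%N -> (0 < j < m)%N -> (i.+1 < j)%N || (j.+1 < i)%N ->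
  GRing.comm (g i) (g j).
Proof.
move=> /andP[i0 im] /andP[j0 jm] /orP[ij|ji]; first by apply: (hs_com hs); rewrite ?ij.
by apply/esym/(hs_com hs); rewrite ?ji.
Qed.

Lemma gen_comm_exprz i (k : int) : (1 < i < m)%N -> GRing.comm (g i) (t ^ k).
Proof. by move=> im; apply/commrXz/esym/(hs_comT hs). Qed.

Lemma ginv_braid i : (0 < i)%N -> (i.+1 < m)%N ->
  (g i)^-1 * (g i.+1)^-1 * g i = g i.+1 * (g i)^-1 * (g i.+1)^-1.
Proof.
move=> i0 im.
have iU : g i \is a GRing.unit by apply: gen_unit; rewrite i0 ltnW.
have jU : g i.+1 \is a GRing.unit by apply: gen_unit.
(* Multiplying by g_(i+1) g_i on the left and on the right gives the braid relation. *)
apply: (mulrI iU); apply: (mulrI jU); apply: (mulIr jU); apply: (mulIr iU).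
by rewrite !mulrA mulrK // divrr // mul1r mulrVK // mulrVK // (hs_three hs).
Qed.

Definition ginv_prod (i : nat) : A := \prod_(1 <= j < i) (g j)^-1.
Local Notation P := ginv_prod.

Lemma ginv_prod1 : P 1%N = 1. Proof. exact: big_geq. Qed.

Lemma ginv_prodS i : (0 < i)%N -> P i.+1 = P i * (g i)^-1.
Proof. by move=> i0; rewrite /P big_nat_recr. Qed.

Lemma ginv_prod_last i : (0 < i < m)%N -> P i.+1 * g i = P i.
Proof. by move=> im; rewrite ginv_prodS ?mulrVK ?gen_unit //; case/andP: im. Qed.

Lemma ginv_prod_next i : (0 < i < m)%N -> P i * g i = (q - 1) *: P i + q *: P i.+1.
Proof.
move=> im; rewrite ginv_prodS; last by case/andP: im.
rewrite {1}(gen_inv_lin im); nc.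
Qed.

Lemma ginv_prod_comm i j : (0 < i)%N -> (i < j < m)%N -> GRing.comm (P i) (g j).
Proof.
move=> i0 /andP[ij jm]; elim: i i0 ij => // -[_ _ _|i IHi _ ij].
  by rewrite ginv_prod1; apply/commr_sym/commr1.
rewrite ginv_prodS //; apply/commr_sym/commrM; first by apply/commr_sym/IHi => //; apply: ltnW.
apply/commrV/gen_comm; rewrite ?ij ?orbT ?(leq_trans _ ij) ?jm //=.
by rewrite (ltn_trans _ (ltn_trans ij jm)).
Qed.

(** On its way left through P_i, the letter g_j commutes with the factors of index above j+1; at
    g_j^-1 g_(j+1)^-1 its index is raised by [ginv_braid], and g_(j+1) commutes with P_j. *)
Lemma ginv_prod_shift i j : (0 < j)%N -> (j.+1 < i <= m)%N -> P i * g j = g j.+1 * P i.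
Proof.
move=> j0 /andP[ji im]; elim: i ji im => // i IHi; rewrite ltnS leq_eqVlt => /orP[/eqP<- im|ji im].
  rewrite !ginv_prodS // -!mulrA (mulrA _^-1) ginv_braid // -!mulrA !mulrA; congr (_ * _ * _).
  by rewrite ginv_prod_comm // leqnn.
have i0 : (0 < i)%N by apply: leq_trans ji.
rewrite ginv_prodS // -mulrA.
have -> : (g i)^-1 * g j = g j * (g i)^-1.
  by apply/commr_sym/commrV/gen_comm; rewrite ?j0 ?i0 ?ji //= (ltn_trans _ im) // ltnW.
by rewrite mulrA IHi ?mulrA // ltnW.
Qed.

(** P_i without its first factor g_1^-1: what is left commutes with t. *)
Definition ginv_prod2 (i : nat) : A := \prod_(2 <= j < i) (g j)^-1.
Local Notation Q := ginv_prod2.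

Lemma ginv_prod_split i : (1 < i)%N -> P i = (g 1%N)^-1 * Q i.
Proof. by move=> i1; rewrite /P big_ltn. Qed.

Lemma ginv_prod2_comm i (k : int) : (i <= m)%N -> GRing.comm (Q i) (t ^ k).
Proof.
move=> im; apply/commr_sym; rewrite /Q big_seq.
apply: commr_prod => j; rewrite mem_index_iota => /andP[j1 ji].
by apply/commrV/commr_sym/gen_comm_exprz; rewrite j1 (leq_trans ji).
Qed.

Lemma t_exprzSr (k : int) : t ^ (k + 1) = t ^ k * t.
Proof. by rewrite exprzDr ?(hs_unit hs) // expr1z. Qed.

Lemma t_exprzS (k : int) : t ^ (k + 1) = t * t ^ k.
Proof. by rewrite addrC exprzDr ?(hs_unit hs) // expr1z. Qed.

Lemma gtg_comm_exprz (k : int) : (1 < m)%N -> GRing.comm (g 1%N * t * g 1%N) (t ^ k).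
Proof.
by move=> m1; apply: commrXz; rewrite /GRing.comm (hs_four hs) // !mulrA.
Qed.

(** The four-term relation makes g_1 t g_1 commute with t^k. Writing g_1 t^k g_1 t as g_1 t^k (g_1 t
    g_1) g_1^-1 thus brings two letters g_1 together, to which the quadratic relation applies; [e1]
    is the outcome, and g_1^-1 is linear in g_1. *)
Lemma bernstein (k : int) : (1 < m)%N ->
  g 1%N * t ^ k * (g 1%N)^-1 * t =
  t * g 1%N * t ^ k * (g 1%N)^-1 + (q - 1) *: (t ^ k * (g 1%N)^-1 * t - (g 1%N)^-1 * t * t ^ k).
Proof.
move=> m1; have U := @gen_unit 1%N m1; set h := (g 1%N)^-1.
have tk : t ^ k * t = t * t ^ k by apply/esym/commrXz.
have e1 : g 1%N * t ^ k * g 1%N * t = (q - 1) *: (t ^ k * g 1%N * t) + q *: (t * g 1%N * t ^ k * h).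
  have -> : g 1%N * t ^ k * g 1%N * t = g 1%N * (t ^ k * (g 1%N * t * g 1%N)) * h.
    by rewrite !mulrA mulrK.
  rewrite -(gtg_comm_exprz k m1) !mulrA (hs_quad hs) // !mulrDl -!scalerAl mul1r.
  by rewrite (gtg_comm_exprz k m1) !mulrA mulrK.
have hE : h = qi *: g 1%N + (qi - 1)%:A by rewrite /h gen_inv.
rewrite {1}hE.
have -> : g 1%N * t ^ k * (qi *: g 1%N + (qi - 1)%:A) * t =
   qi *: (g 1%N * t ^ k * g 1%N * t) + (qi - 1) *: (g 1%N * (t ^ k * t)) by nc.
rewrite e1 !hE tk.
have tk' : t ^ k * (qi *: g 1%N + (qi - 1)%:A) * t =
   qi *: (t ^ k * g 1%N * t) + (qi - 1) *: (t * t ^ k) by rewrite -tk; nc.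
rewrite tk'.
nc.
Qed.

Definition gcox (i : nat) : A := \prod_(j <- rev (index_iota 1 i.+1)) g j.

Lemma gcox0 : gcox 0 = 1. Proof. exact: big_nil. Qed.

Lemma gcoxS i : gcox i.+1 = g i.+1 * gcox i.
Proof.
by rewrite /gcox /index_iota !subSS !subn0 -[in LHS](addn1 i) iotaD rev_cat big_cons.
Qed.

Lemma gcoxK i : (i < m)%N -> gcox i * P i.+1 = 1.
Proof.
elim: i => [|i IHi] im; first by rewrite gcox0 ginv_prod1 mulr1.
by rewrite gcoxS ginv_prodS // mulrA -(mulrA (g _)) IHi ?mulr1 1?ltnW // divrr // gen_unit.
Qed.

Lemma gcox_unit i : (i < m)%N -> gcox i \is a GRing.unit.
Proof.
elim: i => [|i IHi] im; first by rewrite gcox0 unitr1.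
by rewrite gcoxS unitrMl ?IHi ?gen_unit // ltnW.
Qed.

Lemma gcox_catl i n : (i <= n)%N ->
  (\prod_(j <- rev (index_iota i.+1 n.+1)) g j) * gcox i = gcox n.
Proof.
move=> iN; rewrite /gcox -big_cat -rev_cat /index_iota !subSS !subn0.
by rewrite -iotaD subnKC.
Qed.

Lemma gcox_comm k j : (k.+1 < j < m)%N -> gcox k * g j = g j * gcox k.
Proof.
move=> /andP[kj jm]; elim: k kj => [|k IHk] kj; first by rewrite gcox0 mulr1 mul1r.
rewrite gcoxS -mulrA IHk ?(ltnW kj) // !mulrA; congr (_ * _).
by apply: gen_comm; lia.
Qed.

(** The letter g_j commutes with the factors of index below j-1, meets g_j g_(j-1), and the braid
    relation lowers its index. *)
Lemma gcox_shift n j : (1 < j <= n)%N -> (n < m)%N -> gcox n * g j = g j.-1 * gcox n.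
Proof.
case: j => [|[|j]] // /andP[_ jn] nm /=; elim: n jn nm => // n IHn.
rewrite ltnS leq_eqVlt => /orP[/eqP<- jm|jn nm].
  by rewrite !gcoxS -!mulrA gcox_comm ?jm ?ltnSn // !mulrA (hs_three hs).
rewrite gcoxS -mulrA IHn ?(ltnW nm) // !mulrA; congr (_ * _).
by apply/esym/gen_comm; lia.
Qed.

Lemma gcox_conj_exprz i (k : int) : (i < m)%N ->
  (gcox i * t * P i.+1) ^ k = gcox i * t ^ k * P i.+1.
Proof.
move=> im; have CK := gcoxK im; have CU := gcox_unit im; have tU := hs_unit hs.
have PC : P i.+1 * gcox i = 1.
  by apply: (mulrI CU); rewrite mulrA CK mul1r mulr1.
have PU : P i.+1 \is a GRing.unit by apply/unitrP; exists (gcox i).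
have xU : gcox i * t * P i.+1 \is a GRing.unit by rewrite !unitrMl.
move: k; apply: int_step_ind => [|k]; first by rewrite !expr0z mulr1.
have e : gcox i * t ^ (k + 1) * P i.+1 =
    gcox i * t ^ k * P i.+1 * (gcox i * t * P i.+1).
  rewrite exprzDr // expr1z !mulrA.
  by rewrite -(mulrA _ _ (gcox i)) PC mulr1.
rewrite e exprzDr // expr1z; split=> [->//|]; exact: mulIr.
Qed.

End HeckeRelations.

(** * Two-sided linear recurrences *)

Section Recurrence.
Variable R : comNzRingType.

Section OneModule.
Variable M : lmodType R.
Implicit Types (phi psi : int -> M) (us : seq R).

Definition rec_step (v : R) phi : int -> M := fun k => phi (k + 1) - v *: phi k.

(* [recurrent us phi] says that [phi] is annihilated by the product of the
   [S - v], for [v] in [us], where [S] is the shift [k |-> k + 1]. *)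
Fixpoint recurrent us phi : Prop :=
  if us is v :: us' then recurrent us' (rec_step v phi) else forall k, phi k = 0.

Lemma recurrentP us a phi psi :
  recurrent us phi -> recurrent us psi -> recurrent us (fun k => a *: phi k + psi k).
Proof.
elim: us phi psi => [|v us IHus] phi psi /= rphi rpsi.
  by move=> k; rewrite rphi rpsi scaler0 addr0.
have -> : rec_step v (fun k => a *: phi k + psi k) =
    (fun k => a *: rec_step v phi k + rec_step v psi k).
  apply/funext => k; rewrite /rec_step scalerBr !scalerDr !scalerA (mulrC v a).
  by rewrite opprD addrACA.
exact: IHus.
Qed.

Lemma recurrent0 us : recurrent us (fun _ => 0).
Proof.
elim: us => //= v us IHus; rewrite /rec_step.
by under eq_fun do rewrite scaler0 subrr.
Qed.

Lemma recurrent_shift us (j : int) phi :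
  recurrent us phi -> recurrent us (fun k => phi (k + j)).
Proof.
elim: us phi => [|v us IHus] phi /= rphi; first by move=> k.
have -> : rec_step v (fun k => phi (k + j)) = (fun k => rec_step v phi (k + j)).
  by apply/funext => k; rewrite /rec_step addrAC.
exact: IHus.
Qed.

(** As the roots are invertible, the initial values determine the family upwards and downwards. One
    root is peeled off at a time: [rec_step v phi] lies in [S] by induction, then phi(k+1) = v
    phi(k) + [rec_step v phi k] is read in either direction. *)
Lemma recurrent_span us phi (S : M -> Prop) :
  S 0 -> (forall a x y, S x -> S y -> S (a *: x + y)) ->
  all (fun v => `[< exists w, w * v = 1 >]) us ->
  recurrent us phi -> (forall j : nat, (j < size us)%N -> S (phi j)) ->
  forall k, S (phi k).
Proof.
move=> S0 SL; elim: us phi => [|v us IHus] phi /=; first by move=> _ rphi _ k; rewrite rphi.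
case/andP=> /asboolP[w wv] vus rphi Sphi.
have SB x y : S x -> S y -> S (x - v *: y).
  by move=> Sx Sy; rewrite addrC -scaleNr; apply: SL.
have Sstep : forall k, S (rec_step v phi k).
  apply: IHus => // j js; apply: SB; last by apply: Sphi; rewrite ltnW.
  by have := Sphi j.+1 js; rewrite -addn1 PoszD.
apply: int_step_ind => [|k]; first exact: Sphi.
split=> Sk.
  have -> : phi (k + 1) = v *: phi k + rec_step v phi k by rewrite [RHS]addrC subrK.
  exact: SL.
have -> : phi k = w *: phi (k + 1) + ((- w) *: rec_step v phi k + 0).
  by rewrite addr0 scaleNr -scalerBr subKr scalerA wv scale1r.
exact: (SL _ _ _ Sk (SL _ _ _ (Sstep k) S0)).
Qed.

Lemma recurrent_solve (v w : R) (a : M) psi : w * v = 1 ->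
  exists2 phi, phi 0 = a & rec_step v phi = psi.
Proof.
move=> wv.
(* [fp] solves upwards from [a]; [fn j] is the value at [Negz j], that is -(j+1), obtained downwards
   with the inverse [w] of [v]. *)
pose fp := fix fp j := if j is j'.+1 then v *: fp j' + psi (Posz j') else a.
pose fn := fix fn j := w *: ((if j is j'.+1 then fn j' else a) - psi (Negz j)).
exists (fun k => match k with Posz j => fp j | Negz j => fn j end) => //.
apply/funext => -[j|j]; rewrite /rec_step.
  by rewrite -PoszD addn1 /= addrC addKr.
have -> : Negz j + 1 = if j is j'.+1 then Negz j' else 0.
  by case: j => [|j] //; rewrite NegzE -addn1 PoszD opprD subrK NegzE.
have -> : fn j = w *: ((if j is j'.+1 then fn j' else a) - psi (Negz j)) by case: (j).
by rewrite scalerA mulrC wv scale1r; case: j => [|j] /=; rewrite subKr.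
Qed.

Lemma recurrent_extend us (a : nat -> M) :
  all (fun v => `[< exists w, w * v = 1 >]) us ->
  exists2 phi, recurrent us phi & forall j : nat, (j < size us)%N -> phi j = a j.
Proof.
elim: us a => [|v us IHus] a /=; first by exists (fun=> 0).
case/andP=> /asboolP[w wv] /(IHus (fun j => a j.+1 - v *: a j))[psi rpsi psiE].
have [phi phi0 phiE] := recurrent_solve (a 0%N) psi wv.
exists phi => [|j]; first by rewrite phiE.
elim: j => [|j IHj] js; first exact: phi0.
have := psiE j js; rewrite -phiE /rec_step IHj ?(ltnW js) // -PoszD addn1.
by move/addIr.
Qed.

End OneModule.

Lemma recurrent_map (M N : lmodType R) (f : M -> N) us phi :
  linear f -> recurrent us phi -> recurrent us (fun k => f (phi k)).
Proof.
move=> fl; have f0 : f 0 = 0.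
  by have := fl (-1) 0 0; rewrite scaler0 addr0 scaleN1r addNr.
elim: us phi => [|v us IHus] phi /= rphi; first by move=> k; rewrite rphi.
have -> : rec_step v (fun k => f (phi k)) = (fun k => f (rec_step v phi k)).
  apply/funext => k; rewrite /rec_step -!scaleNr.
  by rewrite [in RHS](addrC (phi _)) fl [LHS]addrC.
exact: IHus.
Qed.

Lemma prod_subr_scalar_comm (A : algType R) (t : A) v us :
  GRing.comm (t - v%:A) (\prod_(w <- us) (t - w%:A)).
Proof.
have tC w : GRing.comm t w%:A by rewrite /GRing.comm -scalerAl -scalerAr mul1r mulr1.
apply: commr_prod => w _; apply: commrB; apply: commr_sym.
  by apply: commrB.
by rewrite /GRing.comm -scalerAl -scalerAr mul1r mulr1.
Qed.

(** A step with root v replaces z by (t - v) z, hence the induction with z arbitrary. *)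
Lemma recurrent_exprz (A : unitAlgType R) (t x z : A) us :
  t \is a GRing.unit -> (\prod_(v <- us) (t - v%:A)) * z = 0 ->
  recurrent us (fun k => x * t ^ k * z).
Proof.
move=> tU; elim: us z => [|v us IHus] z /=.
  by rewrite big_nil mul1r => -> k; rewrite mulr0.
rewrite big_cons => tz0.
have -> : rec_step v (fun k => x * t ^ k * z) = (fun k => x * t ^ k * ((t - v%:A) * z)).
  apply/funext => k; rewrite /rec_step exprzDr // expr1z mulrBl mulrBr !mulrA.
  by rewrite -scalerAr mulr1 -scalerAl.
by apply: IHus; rewrite mulrA -prod_subr_scalar_comm.
Qed.

End Recurrence.

(** * The dual module *)

Section DualModule.
Variables (R : comNzRingType) (q qi : R) (A : unitAlgType R).
Hypothesis qK : q * qi = 1.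
Variables (n : nat) (t : A) (g : nat -> A).
Hypothesis hs : hecke_system q n t g.
Local Notation P := (ginv_prod g).

Ltac nc := nc_reduce R A; repeat split; ring.

Implicit Types (F G : nat -> int -> A).

(* [opG j F], [opT F] and [opTi F] give at (i, k) the value at b(i,k) g_j,
   b(i,k) t and b(i,k) t^-1 of the left linear map taking the value F i k at
   each b(i,k). *)
Definition opG (j : nat) F : nat -> int -> A := fun i k =>
  if (i.+1 < j)%N then g j.-1 * F i k
  else if i.+1 == j then (q - 1) *: F i k + q *: F i.+1 k
  else if i == j then F i.-1 k
  else g j * F i k.

Definition opT F : nat -> int -> A := fun i k =>
  if i == 0%N then F 0%N (k + 1)
  else if (n < i)%N then 0
  else t * F i k + (1 - qi) *: (t ^ k * P i * F 0%N 1 - P i * F 0%N (k + 1)).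

Definition opTi F : nat -> int -> A := fun i k =>
  if i == 0%N then F 0%N (k - 1)
  else if (n < i)%N then 0
  else t^-1 * (F i k - (1 - qi) *: (t ^ k * P i * F 0%N 0 - P i * F 0%N k)).

(** * Hecke relations between the operators *)

Lemma opG_lt j F i k : (i.+1 < j)%N -> opG j F i k = g j.-1 * F i k.
Proof. by rewrite /opG => ->. Qed.

Lemma opG_pred F i k : opG i.+1 F i k = (q - 1) *: F i k + q *: F i.+1 k.
Proof. by rewrite /opG ltnn eqxx. Qed.

Lemma opG_diag F i k : opG i.+1 F i.+1 k = F i k.
Proof. by rewrite /opG ltnNge leqnSn /= gtn_eqF ?eqxx. Qed.

Lemma opG_gt j F i k : (j < i)%N -> opG j F i k = g j * F i k.
Proof.
move=> ji; rewrite /opG ltnNge (ltnW (ltnW _)) //=.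
by rewrite !gtn_eqF // ltnW.
Qed.

Lemma opG_lin j a b F G i k :
  opG j (fun i k => a *: F i k + b *: G i k) i k = a *: opG j F i k + b *: opG j G i k.
Proof.
rewrite /opG; case: ltnP => _; first nc.
case: eqP => _; first nc.
case: eqP => _ //; nc.
Qed.

Lemma opT0 F k : opT F 0%N k = F 0%N (k + 1). Proof. by []. Qed.

Lemma opTS F i k : (0 < i <= n)%N -> opT F i k =
  t * F i k + (1 - qi) *: (t ^ k * P i * F 0%N 1 - P i * F 0%N (k + 1)).
Proof. by case/andP=> i0 iN; rewrite /opT gtn_eqF // ltnNge iN. Qed.

Lemma opT_exp0 F i : (0 < i <= n)%N -> opT F i 0 = t * F i 0.
Proof.
by move=> iN; rewrite opTS // expr0z mul1r add0r subrr scaler0 addr0.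
Qed.

(** On rows j-1 and j the operator is the matrix with rows (q-1, q) and (1, 0), a root of X^2 -
    (q-1)X - q; on every other row it multiplies by a generator of H_n. *)
Lemma opG_quad j F i k : (0 < j <= n)%N -> (i <= n)%N ->
  opG j (opG j F) i k = (q - 1) *: opG j F i k + q *: F i k.
Proof.
case: j => // j /andP[_ jn] iN.
have [ij|ji|<-] := ltngtP i j.
- rewrite !opG_lt //= mulrA (hs_quad hs) ?mulrDl -?scalerAl ?mul1r //; lia.
- move: iN; rewrite leq_eqVlt in ji; case/orP: ji => [/eqP<- _|ji iN].
    by rewrite !opG_diag opG_pred.
  rewrite !opG_gt // mulrA (hs_quad hs) ?mulrDl -?scalerAl ?mul1r //; lia.
- by rewrite opG_pred opG_diag.
Qed.

Lemma opG_comm a b F i k : (0 < a)%N -> (a.+1 < b <= n)%N -> (i <= n)%N ->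
  opG a (opG b F) i k = opG b (opG a F) i k.
Proof.
case: a b => // a [|b] // _ /andP[ab bn] iN; rewrite ltnS in ab.
have [ia|ai|ia] := ltngtP i a.
- rewrite !opG_lt /=; try lia.
  rewrite !mulrA (hs_com hs) //; lia.
- rewrite leq_eqVlt in ai; case/orP: ai => [/eqP ai|ai].
    by rewrite -ai opG_diag !(@opG_lt b.+1) ?opG_diag //=; apply: ltnW.
  rewrite !(@opG_gt a.+1) //.
  have [ib|bi|ib] := ltngtP i b.
  + rewrite !(@opG_lt b.+1) ?opG_gt /=; try lia.
    rewrite !mulrA (hs_com hs) //; lia.
  + rewrite leq_eqVlt in bi; case/orP: bi => [/eqP bi|bi].
      by rewrite -bi !opG_diag opG_gt // ltnW.
    rewrite !opG_gt; try lia.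
    rewrite !mulrA (hs_com hs) //; lia.
  + rewrite ib !opG_pred mulrDr -!scalerAr !opG_gt //; lia.
- by rewrite ia opG_pred !(@opG_lt b.+1) ?opG_pred /= ?mulrDr -?scalerAr // ltnW.
Qed.

(** Away from rows j-1, j, j+1 both sides multiply by a braid word of H_n, with indices lowered by
    one for smaller i. The three rows are computed; row j-1 uses the quadratic relation of g_j. *)
Lemma opG_three j F i k : (0 < j)%N -> (j < n)%N -> (i <= n)%N ->
  opG j (opG j.+1 (opG j F)) i k = opG j.+1 (opG j (opG j.+1 F)) i k.
Proof.
case: j => // j _ jn iN.
have [ij|ji|->] := ltngtP i j.
- rewrite !opG_lt /= ?mulrA; try lia.
  by case: j ij jn => // j ij jn /=; rewrite (hs_three hs) // ltnW // ltnW.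
- have [|ji1|->] := ltngtP i j.+1; first by rewrite ltnNge ji.
    have [|ji2|->] := ltngtP i j.+2; first by rewrite ltnNge ji1.
      rewrite !opG_gt; try lia.
      rewrite !mulrA (hs_three hs) //; lia.
    by rewrite opG_gt // !opG_diag opG_lt.
  rewrite !opG_diag (@opG_lt _ _ j) // (opG_pred F j) opG_pred opG_diag.
  by rewrite (@opG_lt _ _ j) // (@opG_gt j.+1) // opG_diag mulrDr -!scalerAr.
- rewrite opG_pred !(@opG_lt j.+2 _ j) // !(opG_pred _ j) !(opG_pred _ j.+1) opG_diag opG_gt //.
  rewrite (@opG_lt j.+2) //= mulrDr -!scalerAr mulrDr -!scalerAr mulrA (hs_quad hs) //.
  nc.
Qed.

Hypothesis n0 : (0 < n)%N.
(** [None] stands for the infinite case, [Some us] for the cyclotomic case with parameters [us]. *)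
Variable ous : option (seq R).
Hypothesis tcyc : if ous is Some us then \prod_(v <- us) (t - v%:A) = 0 else True.

Ltac ncq := nc_reduce R A; repeat split; ring: qK.

(** Row 0 contributes the letter g_(j-1), and the cases follow its passage to the left through P_i:
    it commutes if i < j-1, splits if i = j-1, is absorbed if i = j, and becomes g_j if i > j. *)
Lemma opT_comm j F i k : (1 < j <= n)%N -> (i <= n)%N ->
  opT (opG j F) i k = opG j (opT F) i k.
Proof.
case: j => [|[|j]] // /andP[_ jn]; case: i => [_|i iN].
  by rewrite opT0 !opG_lt // opT0.
have [ij|ji|ij] := ltngtP i j; last 1 first.
- rewrite ij opG_pred !opTS ?(ltnW jn) //.
  rewrite opG_pred !opG_lt //=.
  have e : P j.+1 * g j.+1 = (q - 1) *: P j.+1 + q *: P j.+2.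
    by rewrite (ginv_prod_next qK hs).
  rewrite !mulrA -(mulrA (t ^ k)) e; ncq.
- rewrite opTS // !opG_lt //= opTS //.
  have e : P i.+1 * g j.+1 = g j.+1 * P i.+1 by apply: (ginv_prod_comm hs); lia.
  have e1 : t * g j.+1 = g j.+1 * t by apply: (hs_comT hs); lia.
  have e2 : t ^ k * g j.+1 = g j.+1 * t ^ k by apply/esym/(gen_comm_exprz hs); lia.
  rewrite !mulrA e1 -(mulrA (t ^ k)) e mulrA e2; ncq.
- move: ji iN; rewrite leq_eqVlt => /orP[/eqP <- iN|ji iN].
    rewrite opG_diag !opTS // ?opG_diag ?(@opG_lt _ _ 0%N) //=; last by rewrite ltnW.
    have e : P j.+2 * g j.+1 = P j.+1 by rewrite (ginv_prod_last qK hs).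
    by rewrite !mulrA -(mulrA (t ^ k)) e.
  rewrite opTS // !(@opG_gt _ _ i.+1) // !(@opG_lt _ _ 0%N) //= opTS //.
  have e : P i.+1 * g j.+1 = g j.+2 * P i.+1 by apply: (ginv_prod_shift qK hs); lia.
  have e1 : t * g j.+2 = g j.+2 * t by apply: (hs_comT hs); lia.
  have e2 : t ^ k * g j.+2 = g j.+2 * t ^ k by apply/esym/(gen_comm_exprz hs); lia.
  rewrite !mulrA e1 -(mulrA (t ^ k)) e mulrA e2; ncq.
Qed.

Lemma opTK F i k : (i <= n)%N -> opTi (opT F) i k = F i k.
Proof.
rewrite /opTi; case: i => [_|i iN] /=; first by rewrite opT0 subrK.
rewrite ltnNge iN /= opTS // !opT0 add0r.
by rewrite addrK mulKr // (hs_unit hs).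
Qed.

Lemma opTiK F i k : (i <= n)%N -> opT (opTi F) i k = F i k.
Proof.
case: i => [_|i iN]; first by rewrite opT0 /opTi /= addrK.
rewrite opTS // /opTi /= ltnNge iN /= addrK subrr.
by rewrite mulVKr ?(hs_unit hs) // subrK.
Qed.

(** The operator of g_1 t g_1. The four-term relation is its commutation with [opT]; on row 1 it is
    q times the shift in k, up to a term of row 0. *)
Definition opGTG F := opG 1%N (opT (opG 1%N F)).

Lemma opG_opT0 F k : opG 1%N (opT F) 0%N k =
  q *: (t * F 1%N k) + (q - 1) *: (t ^ k * F 0%N 1).
Proof. rewrite opG_pred opT0 opTS // ginv_prod1; ncq. Qed.

Lemma opGTG1 F k : opGTG F 1%N k = (q - 1) *: F 0%N (k + 1) + q *: F 1%N (k + 1).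
Proof. by rewrite /opGTG opG_diag opT0 opG_pred. Qed.

Lemma opGTG0 F k : opGTG F 0%N k =
  q *: (t * F 0%N k) + (q - 1) *: (t ^ k * ((q - 1) *: F 0%N 1 + q *: F 1%N 1)).
Proof. by rewrite /opGTG opG_opT0 opG_diag opG_pred. Qed.

Lemma opT_four F i k : (i <= n)%N -> opT (opGTG F) i k = opGTG (opT F) i k.
Proof.
case: i => [_|[|i] iN].
- rewrite opT0 !opGTG0 !opT0 !(@opTS _ 1%N) // ginv_prod1 (t_exprzSr hs) expr1z; ncq.
- rewrite opTS // opGTG1 !opGTG0 opGTG1 !opT0 opTS // ginv_prod1 !(t_exprzSr hs) expr1z; ncq.
have n1 : (1 < n)%N by apply: leq_ltn_trans iN.
rewrite opTS // !opGTG0 /opGTG !(@opG_gt 1%N) // opTS // opG_gt //.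
rewrite opTS // !opG_opT0 !(@opG_pred _ 0%N) opG_gt // opTS // !(t_exprzS hs) expr1z.
set s := t ^ k; set h := (g 1%N)^-1; set G := g 1%N; pose Q := ginv_prod2 g i.+2.
(* From row 2 on, P_i is g_1^-1 followed by a factor [Q] that commutes with t, so only g_1^-1
   interacts with t. *)
have -> : P i.+2 = h * Q by apply: ginv_prod_split.
have Qt : Q * t = t * Q by have := ginv_prod2_comm hs 1 iN; rewrite expr1z.
have Qs : Q * s = s * Q by apply: (ginv_prod2_comm hs).
have Qts : Q * (t * s) = t * s * Q by rewrite mulrA Qt -mulrA Qs mulrA.
have esy : t * s = s * t by rewrite /s -(t_exprzS hs) (t_exprzSr hs).
have Gh : G * h = 1 by rewrite divrr // (gen_unit qK hs).
have e4 : t * G * t * G = G * t * G * t by rewrite (hs_four hs).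
have eb : t * G * s * h + (q - 1) *: (s * h * t - h * t * s) = G * s * h * t.
  by rewrite (bernstein qK hs).
have eG : G = (q - 1)%:A + q *: h by rewrite /G (gen_inv_lin qK hs).
have e0 : (q - 1) *: t + q *: (h * t) = G * t by rewrite [in RHS]eG; ncq.
have ex : (q - 1) *: (t * G * s * h) + q *: (s * h * t) +
    ((q - 1) * (q - 1)) *: (s * h * t - h * t * s)
  = G * t * G * s * h + (q - 1) *: (G * s * h * t - G * h * t * s).
  (* Here G t G commutes past s, G h cancels, and the remaining G is (q-1) + q h. *)
  have -> : G * t * G * s * h = (q - 1) *: (t * s) + q *: (s * h * t).
    rewrite (gtg_comm_exprz hs k n1) -/G -/s !mulrA -(mulrA _ G h) Gh mulr1 {1}eG.
    rewrite [t * s]esy; ncq.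
  rewrite -eb Gh mul1r; ncq.
(* Both sides are linear in f, x, x', y, y'; the coefficients agree by e4, ex,
   e0, eb and Gh respectively, the factor Q being moved to the right of t and s. *)
set f := F i.+2 k; set x := F 0%N 1; set x' := F 0%N (k + 1).
set y := F 1%N 1; set y' := F 1%N (k + 1).
transitivity (t * G * t * G * f + (1 - qi) *: (
    ((q - 1) *: (t * G * s * h * Q) + q *: (s * h * (Q * t)) +
      ((q - 1) * (q - 1)) *: (s * h * (Q * t) - h * (Q * (t * s)))) * x
  + q *: ((t * G * s * h * Q + (q - 1) *: (s * h * (Q * t) - h * (Q * (t * s)))) * y)
  - ((q - 1) *: (t * (G * h) * Q) + q *: (h * (Q * t))) * x'
  - q *: (t * (G * h) * Q * y'))); first by ncq.
transitivity (G * t * G * t * f + (1 - qi) *: (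
    (G * t * G * s * h * Q + (q - 1) *: (G * s * h * (Q * t) - G * h * (Q * (t * s)))) * x
  + q *: (G * s * h * (Q * t) * y) - G * t * (G * h) * Q * x'
  - q *: (G * h * (Q * t) * y'))); last by ncq.
rewrite Qt Qts e4 Gh.
transitivity (G * t * G * t * f + (1 - qi) *: (
    ((q - 1) *: (t * G * s * h) + q *: (s * h * t) +
    ((q - 1) * (q - 1)) *: (s * h * t - h * t * s)) * (Q * x)
  + q *: ((t * G * s * h + (q - 1) *: (s * h * t - h * t * s)) * (Q * y))
  - ((q - 1) *: t + q *: (h * t)) * Q * x' - q *: (t * Q * y'))); first by ncq.
rewrite ex eb e0 Gh; ncq.
Qed.

(** * The module of families and the invertible operators on it *)

Definition orec (phi : int -> A) := if ous is Some us then recurrent us phi else True.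

Lemma orecP a phi psi : orec phi -> orec psi -> orec (fun k => a *: phi k + psi k).
Proof. by rewrite /orec; case: ous => // us; apply: recurrentP. Qed.

Lemma orec0 : orec (fun=> 0).
Proof. by rewrite /orec; case: ous => // us; apply: recurrent0. Qed.

Lemma orecD phi psi : orec phi -> orec psi -> orec (fun k => phi k + psi k).
Proof.
by move=> rphi rpsi; under eq_fun do rewrite -[phi _]scale1r; apply: orecP.
Qed.

Lemma orecZ a phi : orec phi -> orec (fun k => a *: phi k).
Proof.
by move=> rphi; under eq_fun do rewrite -[_ *: _]addr0; apply: orecP rphi orec0.
Qed.

Lemma orecB phi psi : orec phi -> orec psi -> orec (fun k => phi k - psi k).
Proof.
by move=> rphi rpsi; under eq_fun do rewrite -scaleN1r; apply/orecD/orecZ.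
Qed.

Lemma orecM x phi : orec phi -> orec (fun k => x * phi k).
Proof.
rewrite /orec; case: ous => // us; apply: (@recurrent_map R A A ( *%R x)).
by move=> a y z; rewrite mulrDr -scalerAr.
Qed.

Lemma orec_shift j phi : orec phi -> orec (fun k => phi (k + j)).
Proof. by rewrite /orec; case: ous => // us; apply: recurrent_shift. Qed.

(** By the cyclotomic relation the powers of t obey the recurrence, so the terms t^k z added by
    [opT] keep a family recurrent. *)
Lemma orec_exprz z : orec (fun k => t ^ k * z).
Proof.
move: tcyc; rewrite /orec; case: ous => // us t0.
have := @recurrent_exprz R A t 1 z us (hs_unit hs).
by rewrite t0 mul0r => /(_ erefl); under eq_fun do rewrite mul1r.
Qed.

Definition in_dual : pred (nat -> int -> A) := fun F =>
  `[< (forall i k, (n < i)%N -> F i k = 0) /\ (forall i, orec (F i)) >].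

Record dual := Dual { dual_fun :> nat -> int -> A; _ : in_dual dual_fun }.

HB.instance Definition _ := [isSub for dual_fun].
HB.instance Definition _ := [Choice of dual by <:].

Fact in_dual_submod : submod_closed in_dual.
Proof.
split=> [|a F G /asboolP[F0 Fr] /asboolP[G0 Gr]]; apply/asboolP; split=> //.
- by move=> i; apply: orec0.
- move=> i k ni; change (a *: F i k + G i k = 0).
  by rewrite F0 ?G0 // scaler0 addr0.
- by move=> i; apply: orecP.
Qed.
HB.instance Definition _ :=
  GRing.isSubmodClosed.Build R (nat -> int -> A) in_dual in_dual_submod.
HB.instance Definition _ := [SubChoice_isSubLmodule of dual by <:].

Lemma dual_supp (F : dual) i k : (n < i)%N -> F i k = 0.
Proof. by case: F => F /= /asboolP[F0 _]; apply: F0. Qed.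

Lemma dual_rec (F : dual) i : orec (F i).
Proof. by case: F => F /= /asboolP[_]. Qed.

Lemma dualP (F G : dual) : (forall i k, (i <= n)%N -> F i k = G i k) -> F = G.
Proof.
move=> FG; apply/val_inj/funext => i; apply/funext => k /=.
by have [iN|ni] := leqP i n; [exact: FG | rewrite (dual_supp F) // (dual_supp G)].
Qed.

(* The index 0 stands for t, the index j > 0 for g_j. *)
Definition gen_op (j : nat) (F : nat -> int -> A) : nat -> int -> A :=
  if j == 0%N then opT F else if (j <= n)%N then opG j F else F.

Definition gen_opi (j : nat) (F : nat -> int -> A) : nat -> int -> A :=
  if j == 0%N then opTi F
  else if (j <= n)%N then fun i k => qi *: opG j F i k + (qi - 1) *: F i k else F.

(** Beyond row n, [opG j] with j <= n multiplies by g_j and [opT] is cut off, so the rows there stay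
    zero. In k there are only shifts, left multiplications and the terms of [orec_exprz]. *)
Lemma gen_op_in j (F : dual) : in_dual (gen_op j F).
Proof.
have Fr := dual_rec F; have F0 := dual_supp F; apply/asboolP.
rewrite /gen_op; case: eqP => [_|/eqP j0]; last case: leqP => // jn.
  split=> [i k ni|i]; rewrite /opT; first by rewrite ni gtn_eqF // (leq_ltn_trans _ ni).
  case: eqP => _; first exact: orec_shift.
  case: ltnP => _; first exact: orec0.
  apply/orecD/orecZ/orecB; first exact: orecM.
    by under eq_fun do rewrite -mulrA; apply: orec_exprz.
  exact/orecM/(orec_shift 1 (Fr _)).
split=> [i k ni|i]; first by rewrite opG_gt ?F0 ?mulr0 // (leq_ltn_trans jn).
rewrite /opG; case: ltnP => _; first exact: orecM.
case: eqP => _; first by apply: orecD; apply: orecZ.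
by case: eqP => _ //; apply: orecM.
Qed.

Lemma gen_opi_in j (F : dual) : in_dual (gen_opi j F).
Proof.
have Fr := dual_rec F; have F0 := dual_supp F; apply/asboolP.
rewrite /gen_opi; case: eqP => [_|/eqP j0]; last case: leqP => // jn.
  split=> [i k ni|i]; rewrite /opTi; first by rewrite ni gtn_eqF // (leq_ltn_trans _ ni).
  case: eqP => _; first exact: orec_shift.
  case: ltnP => _; first exact: orec0.
  apply/orecM/orecB/orecZ/orecB => //; last exact/orecM.
  by under eq_fun do rewrite -mulrA; apply: orec_exprz.
have := gen_op_in j F; rewrite /gen_op (negPf j0) jn => /asboolP[G0 Gr].
split=> [i k ni|i]; first by rewrite G0 // F0 // !scaler0 addr0.
by apply/orecD/orecZ => //; apply: orecZ.
Qed.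

Definition dual_op j (F : dual) : dual := Dual (gen_op_in j F).
Definition dual_opi j (F : dual) : dual := Dual (gen_opi_in j F).

Lemma dual_linE a (F G : dual) i k : (a *: F + G : dual) i k = a *: F i k + G i k.
Proof. by []. Qed.

Lemma dual_opE j (F : dual) i k : dual_op j F i k = gen_op j F i k.
Proof. by []. Qed.

Lemma dual_opiE j (F : dual) i k : dual_opi j F i k = gen_opi j F i k.
Proof. by []. Qed.

Lemma dual_op_linear j : linear (dual_op j).
Proof.
move=> a F G; apply: dualP => i k iN; rewrite dual_linE !dual_opE /gen_op.
case: eqP => _; last case: leqP => // _.
  rewrite /opT; case: eqP => // _; case: ltnP iN => // _ _.
  rewrite !dual_linE; ncq.
rewrite /opG !dual_linE; case: ltnP => _; first ncq.
case: eqP => _; first ncq.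
case: eqP => _ //; ncq.
Qed.

Lemma dual_opi_linear j : linear (dual_opi j).
Proof.
move=> a F G; apply: dualP => i k iN; rewrite dual_linE !dual_opiE /gen_opi.
case: eqP => [_|/eqP j0]; last case: leqP => // jn.
  rewrite /opTi; case: eqP => // _; case: ltnP iN => // _ _.
  rewrite !dual_linE; ncq.
have := congr1 (fun H : dual => H i k) (dual_op_linear j a F G).
rewrite !dual_linE !dual_opE /gen_op (negPf j0) jn => ->.
ncq.
Qed.

Lemma dual_opK j (F : dual) : dual_opi j (dual_op j F) = F.
Proof.
apply: dualP => i k iN /=; rewrite /gen_op /gen_opi.
case: eqP => [_|/eqP j0]; last case: leqP => // jn.
  exact: opTK.
rewrite opG_quad ?jn ?andbT ?lt0n //; ncq.
Qed.

Lemma dual_opiK j (F : dual) : dual_op j (dual_opi j F) = F.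
Proof.
apply: dualP => i k iN /=; rewrite /gen_op /gen_opi.
case: eqP => [_|/eqP j0]; last case: leqP => // jn.
  exact: opTiK.
rewrite opG_lin opG_quad ?jn ?andbT ?lt0n //; ncq.
Qed.

Lemma dual_op_quad j (F : dual) : (0 < j <= n)%N ->
  dual_op j (dual_op j F) = (q - 1) *: dual_op j F + q *: F.
Proof.
case: j => // j jn; apply: dualP => i k iN /=; rewrite /gen_op /= (andP jn).2.
by rewrite opG_quad // (andP jn).2.
Qed.

Lemma dual_op_four (F : dual) :
  dual_op 1 (dual_op 0 (dual_op 1 (dual_op 0 F))) =
  dual_op 0 (dual_op 1 (dual_op 0 (dual_op 1 F))).
Proof.
apply: dualP => i k iN /=; rewrite /gen_op /= n0; apply/esym.
exact: opT_four.
Qed.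

Lemma dual_op_comT j (F : dual) : (1 < j <= n)%N ->
  dual_op 0 (dual_op j F) = dual_op j (dual_op 0 F).
Proof.
case: j => [|j] // jn; apply: dualP => i k iN /=; rewrite /gen_op /= (andP jn).2.
exact: opT_comm.
Qed.

Lemma dual_op_com a b (F : dual) : (0 < a)%N -> (a.+1 < b <= n)%N ->
  dual_op a (dual_op b F) = dual_op b (dual_op a F).
Proof.
case: a b => [|a] // [|b] // _ ab; apply: dualP => i k iN /=.
have /andP[abN bn] := ab.
rewrite /gen_op /= bn (leq_trans (ltnW (ltnW abN)) bn).
exact: opG_comm.
Qed.

Lemma dual_op_three j (F : dual) : (0 < j)%N -> (j < n)%N ->
  dual_op j (dual_op j.+1 (dual_op j F)) = dual_op j.+1 (dual_op j (dual_op j.+1 F)).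
Proof.
case: j => [|j] // _ jn; apply: dualP => i k iN /=.
by rewrite /gen_op /= jn ltnW // opG_three.
Qed.

Fixpoint dual_prod us (F : dual) : dual :=
  if us is v :: us' then dual_prod us' (dual_op 0 F - v *: F) else F.

Lemma dual_prod_comm us (O : dual -> dual) : linear O ->
  (forall F : dual, O (dual_op 0 F) = dual_op 0 (O F)) ->
  forall F : dual, O (dual_prod us F) = dual_prod us (O F).
Proof.
move=> Ol OT; elim: us => //= v us IHus F; rewrite IHus; congr dual_prod.
by rewrite -OT addrC -scaleNr Ol scaleNr [LHS]addrC.
Qed.

Lemma dual_subE v (F G : dual) i k : (F - v *: G : dual) i k = F i k - v *: G i k.
Proof. by []. Qed.

(** On row 0, t acts as the shift in k, so each factor t - v acts as [rec_step v]. *)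
Lemma dual_prod0E us (F : dual) k : recurrent us (F 0%N) -> dual_prod us F 0%N k = 0.
Proof. by elim: us F => [|v us IHus] F /= rF; [apply: rF | apply: IHus]. Qed.

Lemma dual_prodE0 us (F : dual) i : (0 < i <= n)%N ->
  dual_prod us F i 0 = \prod_(v <- us) (t - v%:A) * F i 0.
Proof.
move=> iN; elim: us F => [|v us IHus] F /=; first by rewrite big_nil mul1r.
rewrite IHus dual_subE big_cons prod_subr_scalar_comm -mulrA; congr (_ * _).
rewrite dual_opE /gen_op /= opT_exp0 //.
by rewrite mulrBl -scalerAl mul1r.
Qed.

(* The product vanishes at (0, k) by the recurrence and at (i, 0) since T acts
   there as multiplication by t; as it commutes with [O] below, which moves
   (1, k) to (1, k + 1) modulo (0, k + 1), and with g_2, g_3, etc, it vanishes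
   everywhere. *)
Lemma dual_op_cyclotomic us : ous = Some us -> forall F : dual, dual_prod us F = 0.
Proof.
move=> usE F.
suff key : forall i, (i <= n)%N -> forall (G : dual) k, dual_prod us G i k = 0.
  by apply: dualP => i k iN; rewrite key.
move=> {F} i + G k.
have surj j (H : dual) : exists H1 : dual, H = dual_op j H1.
  by exists (dual_opi j H); rewrite dual_opiK.
have K0 (H : dual) l : dual_prod us H 0%N l = 0.
  by apply: dual_prod0E; have := dual_rec H 0; rewrite /orec usE.
have K1 l (H : dual) : dual_prod us H 1%N l = 0.
  pose O H1 := dual_op 1 (dual_op 0 (dual_op 1 H1)).
  have OE (H1 : dual) l1 : O H1 1%N l1 = (q - 1) *: H1 0%N (l1 + 1) + q *: H1 1%N (l1 + 1).
    by rewrite -[RHS](opGTG1 H1 l1) /O /= /gen_op /= n0.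
  have OC H1 : dual_prod us (O H1) = O (dual_prod us H1).
    apply/esym/dual_prod_comm => [a H2 H3|H2]; first by rewrite /O !dual_op_linear.
    by rewrite /O dual_op_four.
  move: l H; apply: int_step_ind => [H|l].
    by rewrite dual_prodE0 ?n0 //; move: tcyc; rewrite usE => ->; rewrite mul0r.
  split=> K H.
    have := K (O H); rewrite OC OE K0 scaler0 add0r => /(congr1 ( *:%R qi)).
    by rewrite scalerA mulrC qK scale1r scaler0.
  (* The step downwards needs [H] in the image of [O], which is onto as a composite of invertible
     operators. *)
  have [H1 ->] := surj 1%N H; have [H2 ->] := surj 0%N H1; have [H3 ->] := surj 1%N H2.
  by rewrite -/(O H3) OC OE K0 K !scaler0 addr0.
elim: i G k => [|[|i] IHi] G k iN; [exact: K0 | exact: K1 |].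
have [H ->] := surj i.+2 G.
rewrite -(dual_prod_comm _ (dual_op_linear _)) => [|H1]; last by rewrite dual_op_comT.
by rewrite dual_opE /gen_op /= iN opG_diag IHi // ltnW.
Qed.

End DualModule.

(** * The action of the Hecke algebra on the dual module *)

Section BraidRep.
Variables (m : nat) (B : nzRingType) (X Y : nat -> B).
Hypothesis XY : forall i, (i < m)%N -> X i * Y i = 1.
Hypothesis YX : forall i, (i < m)%N -> Y i * X i = 1.
Hypothesis X4 : (1 < m)%N -> X 1%N * X 0%N * X 1%N * X 0%N = X 0%N * X 1%N * X 0%N * X 1%N.
Hypothesis XT : forall i, (1 < i < m)%N -> X 0%N * X i = X i * X 0%N.
Hypothesis XC : forall i j, (0 < i)%N -> (i.+1 < j < m)%N -> X i * X j = X j * X i.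
Hypothesis X3 : forall i, (0 < i)%N -> (i.+1 < m)%N ->
  X i * X i.+1 * X i = X i.+1 * X i * X i.+1.

(** Inverse letters go to the given inverses [Y]: the values lie in a ring, whereas [pres_lift]
    takes values in a group. *)
Definition rep_word (w : word 'I_m) : B := \prod_(p <- w) if p.2 then Y p.1 else X p.1.

Definition braid_repr (b : braidB m) : B := rep_word (repr b).

Lemma rep_word_cat v w : rep_word (v ++ w) = rep_word v * rep_word w.
Proof. exact: big_cat. Qed.

Lemma rep_word_rel l r : braid_rel l r -> rep_word l = rep_word r.
Proof.
case=> {l r} [t s t0 s1|t s t0 s1|s s' s0 s'0 /orP ss'|s s' s0 ss'];
  rewrite /rep_word !big_cons big_nil /= !mulr1 ?mulrA.
- by rewrite t0 s1 X4 // -s1.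
- by rewrite t0 XT // s1 /=.
- by case: ss' => ss'; [rewrite XC // ss' /= | rewrite -XC // ss' /=].
- by rewrite ss' X3 // -ss'.
Qed.

Lemma rep_word_cong v w : word_cong (@braid_rel m) v w -> rep_word v = rep_word w.
Proof.
elim=> {v w} [u v l r h|u v x b|w|w1 w2 _ ->|w1 w2 w3 _ -> _ ->] //.
  by rewrite !rep_word_cat (rep_word_rel h).
rewrite !rep_word_cat; congr (_ * _); rewrite -[RHS]mul1r; congr (_ * _).
by rewrite /rep_word big_cons big_seq1; case: b => /=; rewrite ?XY ?YX.
Qed.

Lemma braid_reprE w : braid_repr (\pi_(presGroup (@braid_rel m)) w) = rep_word w.
Proof. exact: (rep_word_cong (repr_cong _ w)). Qed.

Lemma braid_repr1 : braid_repr 1%g = 1.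
Proof. by rewrite [LHS]braid_reprE /rep_word big_nil. Qed.

Lemma braid_reprM : {morph braid_repr : x y / (x * y)%g >-> x * y}.
Proof.
elim/pres_ind=> x; elim/pres_ind=> y.
by rewrite [(_ * _)%g]pres_mulE !braid_reprE rep_word_cat.
Qed.

Lemma braid_repr_gen i : (i < m)%N -> braid_repr (braid_gen m i) = X i.
Proof.
move=> im; rewrite -[i]/(val (Ordinal im)) braid_genE /pres_gen braid_reprE.
by rewrite /rep_word big_seq1.
Qed.
End BraidRep.

(** Images of words span H_m, and words are built letter by letter at the right end, which matches
    the right multiplications studied on the b(i,k). *)
Lemma hecke_rind p m (S : hecke p m -> Prop) :
  S 1 -> (forall a x y, S x -> S y -> S (a *: x + y)) ->
  (forall x i, (i < m)%N -> S x -> S (x * braid_img p (braid_gen m i))) ->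
  (forall x i, (i < m)%N -> S x -> S (x * (braid_img p (braid_gen m i))^-1)) ->
  forall x, S x.
Proof.
move=> S1 SL SX SV.
have S0 : S 0 by have := SL (-1) 1 1 S1 S1; rewrite scaleN1r addNr.
have SW w : S (braid_img p (\pi_(presGroup (@braid_rel m)) w)).
  elim/last_ind: w => [|w [x b] IHw]; first by rewrite [X in S X]braid_img1.
  rewrite -cats1 -pres_mulE [X in S X]braid_imgM.
  case: b; last first.
    by have := SX _ x (ltn_ord x) IHw; rewrite braid_genE.
  have -> : \pi_(presGroup (@braid_rel m)) [:: (x, true)] = (pres_gen (@braid_rel m) x)^-1%g.
    by rewrite -word_eval_pres /word_eval big_seq1.
  rewrite [X in S (_ * X)]braid_imgV.
  by have := SV _ x (ltn_ord x) IHw; rewrite braid_genE.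
elim/quot_ind => x; elim/ga_ind: x => [c b|x y Sx Sy].
  elim/pres_ind: b => w; have := SL c _ _ (SW w) S0; rewrite addr0.
  congr S; rewrite /braid_img /hecke_pi -quot_pi_scalable; congr quot_pi.
  by rewrite ga_of.unlock ga_scaleU mulr1.
by have := SL 1 _ _ Sx Sy; rewrite scale1r -rmorphD.
Qed.

(** * The relations in the presented algebras *)

Section HeckeSystem.
Variable p : level.

Definition level_vars : option (seq laurent) :=
  if p is @Cyclotomic d _ then Some [seq uL j | j <- index_iota 1 d.+1] else None.

Definition qLV : laurent := ga_of int ((lvar 0)^-1)%g.

Lemma qL_mulV : qL * qLV = 1.
Proof. by rewrite -ga_ofM mulgV. Qed.

Lemma uL_unit j : exists w : laurent, w * uL j = 1.
Proof. by exists (ga_of int ((lvar j)^-1)%g); rewrite -ga_ofM mulVg. Qed.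

Lemma braid_gen_comT m i : (1 < i < m)%N ->
  (braid_gen m 0 * braid_gen m i = braid_gen m i * braid_gen m 0)%g.
Proof.
move=> /andP[i1 im]; have m0 : (0 < m)%N by apply: leq_ltn_trans im.
have := braid_gen_rel (BraidComT (t := Ordinal m0) (s := Ordinal im) erefl i1).
by rewrite /word_eval !big_cons !big_nil /letter_eval /= !mulg1.
Qed.

Lemma braid_gen_com m i j : (0 < i)%N -> (i.+1 < j < m)%N ->
  (braid_gen m i * braid_gen m j = braid_gen m j * braid_gen m i)%g.
Proof.
move=> i0 /andP[ij jm]; have im : (i < m)%N by apply: ltn_trans jm; apply: ltnW.
have j0 : (0 < j)%N by apply: leq_trans ij.
have ijj : (i.+1 < j)%N || (j.+1 < i)%N by rewrite ij.
have := braid_gen_rel (BraidCom (s := Ordinal im) (s' := Ordinal jm) i0 j0 ijj).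
by rewrite /word_eval !big_cons !big_nil /letter_eval /= !mulg1.
Qed.

Lemma braid_gen_three m i : (0 < i)%N -> (i.+1 < m)%N ->
  (braid_gen m i * braid_gen m i.+1 * braid_gen m i =
   braid_gen m i.+1 * braid_gen m i * braid_gen m i.+1)%g.
Proof.
move=> i0 jm; have im : (i < m)%N by apply: ltnW.
have := braid_gen_rel (BraidThree (s := Ordinal im) (s' := Ordinal jm) i0 erefl).
by rewrite /word_eval !big_cons !big_nil /letter_eval /= !mulg1 !mulgA.
Qed.

Lemma braid_gen_four m : (1 < m)%N ->
  (braid_gen m 1 * braid_gen m 0 * braid_gen m 1 * braid_gen m 0 =
   braid_gen m 0 * braid_gen m 1 * braid_gen m 0 * braid_gen m 1)%g.
Proof.
move=> m1; have m0 : (0 < m)%N by apply: ltnW.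
have := braid_gen_rel (BraidFour (t := Ordinal m0) (s1 := Ordinal m1) erefl erefl).
by rewrite /word_eval !big_cons !big_nil /letter_eval /= !mulg1 !mulgA.
Qed.

Lemma hecke_is_system m : hecke_system qL m (tH p m) (gH p m).
Proof.
split.
- exact: braid_img_unit.
- move=> i im; rewrite -expr2; exact: heckeOver_quadratic.
- by move=> m1; rewrite /tH /gH -!braid_imgM braid_gen_four.
- by move=> i im; rewrite /tH /gH -!braid_imgM braid_gen_comT.
- by move=> i j i0 ij; rewrite /tH /gH -!braid_imgM braid_gen_com.
- by move=> i i0 im; rewrite /tH /gH -!braid_imgM braid_gen_three.
Qed.

Lemma hecke_cyclotomic m : (0 < m)%N -> if level_vars is Some us then
  \prod_(v <- us) (tH p m - v%:A) = 0 else True.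
Proof.
rewrite /level_vars => m0; have := @heckeOver_cyclotomic laurent qL uL p m.
by case: p => // d d0 /(_ d d0 m0 erefl); rewrite big_map.
Qed.

End HeckeSystem.

(** In the cyclotomic case the exponents 0, ..., d-1 index the free initial values of the
    recurrence, and the u_j are invertible, so a delta on them extends to all of Z. *)
Lemma rec_delta p (A : unitAlgType laurent) (k0 : int) : k0 \in exponent p ->
  exists2 phi : int -> A, orec (level_vars p) phi &
    forall k, k \in exponent p -> phi k = (k == k0)%:R.
Proof.
rewrite /orec /level_vars; case: p => [_|d d0 /= k0d].
  by exists (fun k => (k == k0)%:R).
have us_unit : all (fun v => `[< exists w : laurent, w * v = 1 >])
    [seq uL j | j <- index_iota 1 d.+1].
  by apply/allP => v /mapP[j _ ->]; apply/asboolP/uL_unit.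
have [phi rphi phiE] := recurrent_extend (fun j => (j%:Z == k0)%:R : A) us_unit.
exists phi => // k; rewrite inE; case: k => [k|//] /andP[_ kd].
by rewrite phiE // size_map size_iota subn1.
Qed.

(** * Delta families and the representation of H_(n+1) *)

Section Independence.
Variables (p : level) (n : nat).
Hypothesis n0 : (0 < n)%N.
Notation A := (hecke p n).
Notation t := (tH p n).
Notation g := (gH p n).
Let hs : hecke_system qL n t g := hecke_is_system p n.
Let tcyc := @hecke_cyclotomic p n n0.
Notation V := (dual A n (level_vars p)).

Lemma dual_delta i0 (k0 : int) : (i0 <= n)%N -> k0 \in exponent p ->
  exists F : V, forall i k, (i <= n)%N -> k \in exponent p ->
    F i k = ((i == i0) && (k == k0))%:R.
Proof.
move=> i0n k0p.
have [phi rphi phiE] := rec_delta A k0p.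
pose F i : int -> A := if i == i0 then phi else fun=> 0.
have Fin : in_dual n (level_vars p) F.
  apply/asboolP; rewrite /F; split=> [i k ni|i].
    by rewrite gtn_eqF // (leq_ltn_trans i0n).
  by case: eqP => // _; apply: orec0.
exists (Dual Fin) => i k iN kp /=; rewrite /F.
by case: eqP => //= _; rewrite phiE.
Qed.

Lemma exponent0 : 0 \in exponent p.
Proof. by case: p. Qed.

Fact dual_neq0 : exists v : V, v != 0.
Proof.
have [F FE] := dual_delta (leqnn n) exponent0.
exists F; apply/eqP => F0; have := FE _ _ (leqnn n) exponent0.
rewrite F0 !eqxx => /esym/eqP; apply/negP; exact: oner_neq0.
Qed.

Let v0 : V := xchoose dual_neq0.
Let v0_neq0 : v0 != 0 := xchooseP dual_neq0.
Notation E := (endo_alg v0_neq0).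

Let X j : E := mk_endo (dual_op_linear qL_mulV hs tcyc j).
Let Y j : E := mk_endo (dual_opi_linear qL_mulV hs tcyc j).

Let XY i : (i < n.+1)%N -> X i * Y i = 1.
Proof. by move=> _; apply: endoP => F; exact: (dual_opiK qL_mulV hs tcyc). Qed.

Let YX i : (i < n.+1)%N -> Y i * X i = 1.
Proof. by move=> _; apply: endoP => F; exact: (dual_opK qL_mulV hs tcyc). Qed.

Let X4 : (1 < n.+1)%N -> X 1%N * X 0%N * X 1%N * X 0%N = X 0%N * X 1%N * X 0%N * X 1%N.
Proof. by move=> _; apply: endoP => F; exact: (dual_op_four qL_mulV hs n0 tcyc). Qed.

Let XT i : (1 < i < n.+1)%N -> X 0%N * X i = X i * X 0%N.
Proof. by move=> iN; apply: endoP => F; exact: (dual_op_comT qL_mulV hs n0 tcyc). Qed.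

Let XC i j : (0 < i)%N -> (i.+1 < j < n.+1)%N -> X i * X j = X j * X i.
Proof. by move=> i0 iN; apply: endoP => F; apply: dual_op_com. Qed.

Let X3 i : (0 < i)%N -> (i.+1 < n.+1)%N -> X i * X i.+1 * X i = X i.+1 * X i * X i.+1.
Proof. by move=> i0 iN; apply: endoP => F; apply: dual_op_three. Qed.

Let phi : braidB n.+1 -> E := braid_repr X Y.

Let phi1 : phi 1%g = 1. Proof. exact: braid_repr1 XY YX X4 XT XC X3. Qed.
Let phiM : {morph phi : x y / (x * y)%g >-> x * y}.
Proof. exact: braid_reprM XY YX X4 XT XC X3. Qed.
Let phi_gen i : (i < n.+1)%N -> phi (braid_gen n.+1 i) = X i.
Proof. exact: braid_repr_gen XY YX X4 XT XC X3 i. Qed.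

Let phiQ i : (0 < i < n.+1)%N ->
  phi (braid_gen n.+1 i) ^+ 2 = (qL - 1) *: phi (braid_gen n.+1 i) + qL%:A.
Proof.
move=> /andP[i0 iN]; rewrite phi_gen // expr2; apply: endoP => F.
by apply: dual_op_quad; rewrite i0.
Qed.

Let prodE us (F : V) : (\prod_(v <- us) (X 0%N - v%:A) : endo V) F =
  dual_prod qLV hs tcyc us F.
Proof.
elim: us F => [|v us IHus] F /=; first by rewrite big_nil.
by rewrite -IHus big_cons prod_subr_scalar_comm.
Qed.

Let phiC d (d0 : (0 < d)%N) : (0 < n.+1)%N -> p = Cyclotomic d0 ->
  \prod_(1 <= j < d.+1) (phi (braid_gen n.+1 0) - (uL j)%:A) = 0.
Proof.
move=> _ pE; rewrite phi_gen // -(big_map uL predT (fun v => X 0%N - v%:A)).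
have usE : level_vars p = Some [seq uL j | j <- index_iota 1 d.+1] by rewrite pE.
apply: endoP => F; rewrite (prodE _ F).
exact: (dual_op_cyclotomic qL_mulV hs n0 tcyc usE).
Qed.

Let Psi : hecke p n.+1 -> E := hecke_lift phi.

Let PsiZ : zmod_morphism Psi. Proof. exact: hecke_lift_zmod phi1 phiM phiQ phiC. Qed.
Let PsiM : monoid_morphism Psi. Proof. exact: hecke_lift_monoid phi1 phiM phiQ phiC. Qed.
Let PsiS : scalable Psi. Proof. exact: hecke_lift_scalable phi1 phiM phiQ phiC. Qed.
HB.instance Definition _ := GRing.isZmodMorphism.Build (hecke p n.+1) E Psi PsiZ.
HB.instance Definition _ := GRing.isMonoidMorphism.Build (hecke p n.+1) E Psi PsiM.
HB.instance Definition _ := GRing.isScalable.Build laurent (hecke p n.+1) E *:%R Psi PsiS.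

Let Psi_gen i : (i < n.+1)%N -> Psi (braid_img p (braid_gen n.+1 i)) = X i.
Proof.
move=> iN; rewrite -phi_gen // /Psi /braid_img /hecke_pi.
by rewrite (hecke_lift_pi phi1 phiM phiQ phiC); apply: ga_lift_of.
Qed.

Definition dual_act (x : hecke p n.+1) (F : V) : V := (Psi x : endo V) F.

Lemma dual_actM x y F : dual_act (x * y) F = dual_act x (dual_act y F).
Proof. by rewrite /dual_act rmorphM. Qed.

Lemma dual_act1 F : dual_act 1 F = F.
Proof. by rewrite /dual_act rmorph1. Qed.

Lemma dual_actD x y F : dual_act (x + y) F = dual_act x F + dual_act y F.
Proof. by rewrite /dual_act rmorphD. Qed.

Lemma dual_actZ a x F : dual_act (a *: x) F = a *: dual_act x F.
Proof. by rewrite /dual_act linearZ. Qed.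

Lemma dual_act_g j F i k : (0 < j <= n)%N ->
  dual_act (gH p n.+1 j) F i k = opG qL g j F i k.
Proof. by case: j => // j /= jn; rewrite /dual_act Psi_gen //= /gen_op /= jn. Qed.

Lemma dual_act_t F i k : dual_act (tH p n.+1) F i k = opT qLV n t g F i k.
Proof. by rewrite /dual_act Psi_gen. Qed.
End Independence.

(** * Spanning *)

Section LeftSpan.
Variables (R : comNzRingType) (A : algType R) (L E : A -> Prop).

(** In the application [L] is the image of H_n; [E] is first the set of all b(i,k), then the set of
    basis elements. *)
Inductive lspan : A -> Prop :=
| LspanGen l b : L l -> E b -> lspan (l * b)
| Lspan0 : lspan 0
| LspanD x y : lspan x -> lspan y -> lspan (x + y).

Hypothesis LM : forall l l', L l -> L l' -> L (l * l').
Hypothesis LZ : forall a, L a%:A.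

Lemma lspanM l x : L l -> lspan x -> lspan (l * x).
Proof.
move=> Ll; elim=> {x} [l' b Ll' Eb||x y _ Sx _ Sy].
- by rewrite mulrA; apply: LspanGen => //; apply: LM.
- by rewrite mulr0; apply: Lspan0.
- by rewrite mulrDr; apply: LspanD.
Qed.

Lemma lspanZ a x : lspan x -> lspan (a *: x).
Proof. by move=> Sx; rewrite -[x]mul1r scalerAl; apply: lspanM. Qed.

Lemma lspanB x y : lspan x -> lspan y -> lspan (x - y).
Proof. by move=> Sx Sy; rewrite -scaleN1r; apply/LspanD/lspanZ. Qed.

Lemma lspan_base b : E b -> lspan b.
Proof. by move=> Eb; rewrite -[b]mul1r -(scale1r 1); apply: LspanGen. Qed.

Lemma lspan_mulr z : (forall b, E b -> lspan (b * z)) ->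
  forall x, lspan x -> lspan (x * z).
Proof.
move=> Ez x; elim=> {x} [l b Ll Eb||x y _ Sx _ Sy].
- by rewrite -mulrA; apply: lspanM => //; apply: Ez.
- by rewrite mul0r; apply: Lspan0.
- by rewrite mulrDl; apply: LspanD.
Qed.

Lemma lspan_mulrV z w a b : w = a *: z + b%:A ->
  (forall x, lspan x -> lspan (x * z)) -> forall x, lspan x -> lspan (x * w).
Proof.
move=> -> Sz x Sx; rewrite mulrDr -!scalerAr mulr1.
by apply: LspanD; apply: lspanZ => //; apply: Sz.
Qed.

End LeftSpan.

Lemma lspan_sub (R : comNzRingType) (A : algType R) (L E E' : A -> Prop) x :
  (forall l l', L l -> L l' -> L (l * l')) -> (forall b, E b -> lspan L E' b) ->
  lspan L E x -> lspan L E' x.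
Proof.
move=> LM EE'; elim=> {x} [l b Ll /EE' Sb||x y _ Sx _ Sy].
- exact: lspanM.
- exact: Lspan0.
- exact: LspanD.
Qed.


(** * Stability of the span of the b(i,k) *)

Section BeltSpan.
Variables (R : comNzRingType) (q qi : R) (A : unitAlgType R).
Hypothesis qK : q * qi = 1.
Variables (n : nat) (t : A) (g : nat -> A).
Hypothesis hs : hecke_system q n.+1 t g.
(* [belt i k] is b(i,k). *)
Definition belt i (k : int) : A := gcox g n * t ^ k * ginv_prod g i.+1.

(** [gcox n] is g_n ... g_(i+1) times [gcox i], whose inverse is P_(i+1). The same factorization
    gives [belt_tprime], conjugation by [gcox i] being compatible with powers. *)
Lemma belt_gdesc i : (i <= n)%N ->
  \prod_(j <- rev (index_iota i.+1 n.+1)) g j = belt i 0.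
Proof.
move=> iN; rewrite /belt expr0z mulr1 -(gcox_catl _ iN) -mulrA.
by rewrite (gcoxK qK hs) ?mulr1.
Qed.

Lemma belt_tprime i k : (i <= n)%N ->
  (\prod_(j <- rev (index_iota i.+1 n.+1)) g j) *
    (gcox g i * t * ginv_prod g i.+1) ^ k = belt i k.
Proof.
by move=> iN; rewrite (gcox_conj_exprz qK hs) // !mulrA gcox_catl.
Qed.

Variable L : A -> Prop.
Hypothesis LM : forall l l', L l -> L l' -> L (l * l').
Hypothesis LZ : forall a, L a%:A.
Hypothesis Lg : forall j, (0 < j < n)%N -> L (g j).
Hypothesis Lt : forall k : int, L (t ^ k).
Notation C := (gcox g n).
Notation P := (ginv_prod g).
Notation Q := (ginv_prod2 g).

Definition is_belt (b : A) := exists i k, (i <= n)%N /\ b = belt i k.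
Notation S := (lspan L is_belt).

Ltac nc := nc_reduce R A; repeat split; ring: qK.

Lemma belt_span i k : (i <= n)%N -> S (belt i k).
Proof. by move=> iN; apply: lspan_base => //; exists i, k. Qed.

(** For j > 1, g_j commutes with t^k, and in passing [gcox n] it becomes g_(j-1), a generator of
    H_n. *)
Lemma belt_shift (k : int) j (x : A) : (1 < j <= n)%N ->
  C * t ^ k * (g j * x) = g j.-1 * (C * t ^ k * x).
Proof.
move=> jn; rewrite mulrA -(mulrA C) -(gen_comm_exprz hs); last by rewrite ltnS.
by rewrite mulrA (gcox_shift hs) // !mulrA.
Qed.

Lemma belt_g j i k : (0 < j <= n)%N -> (i <= n)%N -> S (belt i k * g j).
Proof.
move=> jn iN; rewrite /belt -mulrA.
have [ij|ji|ij] := ltngtP i.+1 j; last 1 first.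
- rewrite -ij (ginv_prod_next qK hs); last lia.
  have -> : C * t ^ k * ((q - 1) *: P i.+1 + q *: P i.+2) =
    (q - 1) *: belt i k + q *: belt i.+1 k by rewrite /belt; nc.
  by apply: LspanD; apply: lspanZ => //; apply: belt_span; rewrite // ij; case/andP: jn.
- rewrite (ginv_prod_comm hs); try lia.
  rewrite belt_shift; last lia.
  by apply: lspanM => //; [apply: Lg; lia | apply: belt_span].
- rewrite leq_eqVlt in ji; case/orP: ji => [/eqP [ji]|ji].
    by rewrite -ji in iN *; rewrite (ginv_prod_last qK hs) ?jn //; case: j {ji} jn iN => // j _ jn;
      apply: belt_span; apply: ltnW.
  rewrite (ginv_prod_shift qK hs); try lia.
  rewrite belt_shift; last lia.
  by apply: lspanM => //; [apply: Lg; lia | apply: belt_span].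
Qed.

Lemma span_g j x : (0 < j <= n)%N -> S x -> S (x * g j).
Proof. by move=> jn; apply: lspan_mulr => // _ [i [k [iN ->]]]; apply: belt_g. Qed.

Lemma span_gV j x : (0 < j <= n)%N -> S x -> S (x * (g j)^-1).
Proof.
move=> jn; apply: lspan_mulrV => //; first exact: (gen_inv qK hs).
by move=> y; apply: span_g.
Qed.

Lemma span_Q i x : (i <= n.+1)%N -> S x -> S (x * Q i).
Proof.
rewrite /ginv_prod2; elim: i => [|i IHi] iN Sx; first by rewrite big_geq // mulr1.
have [i1|i1] := leqP i 1; first by rewrite big_geq // mulr1.
rewrite big_nat_recr //= mulrA; apply: span_gV; last exact/IHi/Sx/ltnW.
lia.
Qed.

Lemma gcox_split : (0 < n)%N -> exists2 D, C = D * g 1%N & GRing.comm D t.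
Proof.
move=> n0; exists (\prod_(j <- rev (index_iota 2 n.+1)) g j).
  rewrite -(gcox_catl g n0); congr (_ * _).
  by rewrite gcoxS gcox0 mulr1.
rewrite big_seq; apply/commr_sym/commr_prod => j.
rewrite mem_rev mem_index_iota => jn; exact: (hs_comT hs).
Qed.

(** This is [bernstein] multiplied by D = g_n ... g_2 on the left and by Q on the right, both of
    which commute with t. *)
Lemma belt_t i k : (0 < i <= n)%N -> belt i k * t = t * belt i k +
  (1 - qi) *: (t ^ k * (belt 0%N 1 * Q i.+1) - belt 0%N (k + 1) * Q i.+1).
Proof.
case/andP=> i0 iN; have n0 : (0 < n)%N by apply: leq_trans iN.
have [D DE Dt] := gcox_split n0.
have Dtk : D * t ^ k = t ^ k * D by apply: commrXz.
have Qt : Q i.+1 * t = t * Q i.+1.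
  by have := ginv_prod2_comm hs 1 (iN : (i.+1 <= n.+1)%N); rewrite expr1z.
have hE := @gen_inv _ _ _ _ qK _ _ _ hs 1%N n0.
have b := bernstein qK hs k (n0 : (1 < n.+1)%N).
have tk : t * t ^ k = t ^ k * t by apply: commrXz.
(* The correction terms are rewritten with g_1 in place of g_1^-1, the scalar parts cancelling, so
   that multiplication by D turns them into b(0,1) and b(0,k+1). *)
have b' : g 1%N * t ^ k * (g 1%N)^-1 * t = t * g 1%N * t ^ k * (g 1%N)^-1 +
    (1 - qi) *: (t ^ k * g 1%N * t - g 1%N * (t ^ k * t)).
  rewrite b; congr (_ + _); rewrite hE.
  transitivity ((q - 1) *: (qi *: (t ^ k * g 1%N * t - g 1%N * (t * t ^ k)) +
     (qi - 1) *: (t ^ k * t - t * t ^ k))); first by nc.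
  by rewrite tk subrr scaler0 addr0 scalerA mulrBl qK mul1r.
rewrite /belt (ginv_prod_split g (i0 : (1 < i.+1)%N)) ginv_prod1 DE.
transitivity (D * (g 1%N * t ^ k * (g 1%N)^-1 * t) * Q i.+1).
  by rewrite -!mulrA Qt.
rewrite b' (t_exprzSr hs) expr1z.
transitivity ((D * t) * (g 1%N * t ^ k * (g 1%N)^-1 * Q i.+1) +
   (1 - qi) *: ((D * t ^ k) * g 1%N * t * Q i.+1 - D * (g 1%N * (t ^ k * t)) * Q i.+1)).
  nc.
rewrite Dt Dtk; nc.
Qed.

Lemma span_t x : S x -> S (x * t).
Proof.
apply: lspan_mulr => // _ [[|i] [k [iN ->]]].
  rewrite /belt ginv_prod1 mulr1 -mulrA -(t_exprzSr hs) -[X in S X]mulr1 -(ginv_prod1 g).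
  exact: belt_span.
rewrite belt_t //; apply: LspanD.
  by apply: lspanM => //; [have := Lt 1; rewrite expr1z | apply: belt_span].
apply: lspanZ => //; apply: lspanB => //; first apply: lspanM => //;
  by apply: span_Q => //; apply: belt_span.
Qed.

Lemma span_tV x : S x -> S (x * t^-1).
Proof.
have tU := hs_unit hs.
have b0 k : belt 0%N k * t^-1 = belt 0%N (k - 1).
  rewrite /belt ginv_prod1 !mulr1 -mulrA; congr (_ * _).
  by apply: (mulIr tU); rewrite mulrVK // -(t_exprzSr hs) subrK.
apply: lspan_mulr => // _ [[|i] [k [iN ->]]].
  by rewrite b0; apply: belt_span.
have Qt : Q i.+2 * t = t * Q i.+2.
  by have := ginv_prod2_comm hs 1 (iN : (i.+2 <= n.+1)%N); rewrite expr1z.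
have QtV : Q i.+2 * t^-1 = t^-1 * Q i.+2 by apply: commrV.
(* This is [belt_t] solved for the product with t^-1, and t^-1 lies in [L]. *)
have -> : belt i.+1 k * t^-1 = t^-1 * (belt i.+1 k -
    (1 - qi) *: (t ^ k * (belt 0%N 0 * Q i.+2) - belt 0%N k * Q i.+2)).
  apply: (mulrI tU); rewrite mulVKr // mulrA.
  have b0t l : belt 0%N l * t = belt 0%N (l + 1).
    by rewrite /belt ginv_prod1 !mulr1 -mulrA -(t_exprzSr hs).
  apply: (mulIr tU); rewrite mulrVK // mulrBl belt_t // -scalerAl mulrBl.
  rewrite -(mulrA (t ^ k)) -!(mulrA (belt 0%N _)) Qt.
  by rewrite !(mulrA (belt 0%N _)) !b0t add0r addrK.
have LtV : L t^-1 by have := Lt (-1); rewrite exprN1.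
apply: lspanM => //; apply: lspanB => //; first exact: belt_span.
apply: lspanZ => //; apply: lspanB => //; first apply: lspanM => //;
  by apply: span_Q => //; apply: belt_span.
Qed.

End BeltSpan.

(** * Basis words as elements b(i,k) *)

Section BasisShape.
Variables (p : level) (n : nat).
Notation t := (tH p n.+1).
Notation g := (gH p n.+1).

(** As b(i,0) = g_n ... g_(i+1), the empty word is b(n,0) and g_n ... g_i is b(i-1,0). *)
Definition basis_row (w : basis_word) : nat :=
  match w with Word1 => n | Word2 i => i.-1 | Word3 i _ => i | Word4 _ => n end.

Definition basis_exp (w : basis_word) : int :=
  match w with Word1 | Word2 _ => 0 | Word3 _ k | Word4 k => k end.

Lemma basis_row_le w : admissible p n w -> (basis_row w <= n)%N.
Proof. by case: w => //= [[|i] //= /ltnW //|i k /andP[iN _]]; lia. Qed.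

Lemma basis_exp_in w : admissible p n w -> basis_exp w \in exponent p.
Proof. by case: w => [|i|i k|k] /=; rewrite ?exponent0 // => h; case/andP: h => // _ /andP[]. Qed.

Hypothesis n0 : (0 < n)%N.

Lemma basis_eltE w : admissible p n w ->
  basis_elt p n w = belt n t g (basis_row w) (basis_exp w).
Proof.
have hs := hecke_is_system p n.+1.
have gd i := belt_gdesc qL_mulV hs (i := i).
have tp i k := belt_tprime qL_mulV hs (i := i) k.
have iota0 : index_iota n.+1 n.+1 = [::] by rewrite /index_iota subnn.
case: w => [|i|i k|k].
- by move=> _; rewrite -[RHS](gd n (leqnn n)) iota0 big_nil.
- by case: i => // i /= iN; apply: gd; apply: ltnW.
- move=> /andP[iN _]; apply: tp; exact: leq_trans iN (leq_pred _).
- by move=> _; rewrite -[RHS](tp n k (leqnn n)) iota0 big_nil mul1r.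
Qed.

(** Together with [basis_word_of], this matches the admissible words with the pairs (i,k), i <= n
    and k in Z. The condition k != 0 separates types 3 and 4 from 1 and 2; the range of i separates
    1 from 2 and 3 from 4. *)
Lemma basis_row_exp_inj w w' : admissible p n w -> admissible p n w' ->
  basis_row w = basis_row w' -> basis_exp w = basis_exp w' -> w = w'.
Proof.
case: w w' => [|i|i k|k] [|i'|i' k'|k'] //=.
- lia.
- by move=> _ /and3P[_ _ /eqP k0] _ /esym.
- by move=> _ /andP[_ /eqP k0] _ /esym.
- lia.
- by move=> iN iN' e _; congr Word2; lia.
- by move=> _ /and3P[_ _ /eqP k0] _ /esym.
- by move=> _ /andP[_ /eqP k0] _ /esym.
- by move=> /and3P[_ _ /eqP k0].
- by move=> /and3P[_ _ /eqP k0].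
- by move=> _ _ -> ->.
- by move=> /andP[i0 _] _; lia.
- by move=> /andP[_ /eqP k0].
- by move=> /andP[_ /eqP k0].
- by move=> _ /andP[i0 _]; lia.
- by move=> _ _ _ ->.
Qed.

Lemma basis_word_of i k : (i <= n)%N -> k \in exponent p ->
  exists2 w, admissible p n w & basis_row w = i /\ basis_exp w = k.
Proof.
move=> iN kp; have [k0|k0] := eqVneq k 0; have [ei|ni] := eqVneq i n.
- by exists Word1.
- by exists (Word2 i.+1) => //=; rewrite ltn_neqAle ni iN.
- by exists (Word4 k); rewrite //= kp.
- by exists (Word3 i k) => //=; rewrite kp k0 !andbT; lia.
Qed.

End BasisShape.

Lemma mulr_linear_l (R : comNzRingType) (A : algType R) a (x y z : A) :
  (a *: x + y) * z = a *: (x * z) + y * z.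
Proof. by rewrite mulrDl scalerAl. Qed.

(** * Evaluation at (n,0) *)

Section Evaluation.
Variables (p : level) (n : nat).
Hypothesis n0 : (0 < n)%N.
Notation V := (dual (hecke p n) n (level_vars p)).
Notation act := (dual_act n0).
Notation t := (tH p n.+1).
Notation g := (gH p n.+1).
Implicit Types (F : V) (x : hecke p n.+1).

Let tU : t \is a GRing.unit. Proof. exact: braid_img_unit. Qed.
Let gU j : g j \is a GRing.unit. Proof. exact: braid_img_unit. Qed.

Lemma act_gcox j F k : (j <= n)%N -> act (gcox g j) F j k = F 0%N k.
Proof.
elim: j => [_|j IHj jn]; first by rewrite gcox0 dual_act1.
by rewrite gcoxS dual_actM dual_act_g // opG_diag IHj // ltnW.
Qed.

Lemma act_exprz F (k l : int) : act (t ^ k) F 0%N l = F 0%N (l + k).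
Proof.
have tS m : t ^ (m + 1) = t * t ^ m by rewrite addrC exprzDr ?expr1z.
move: k l; apply: int_step_ind => [l|k].
  by rewrite expr0z dual_act1 addr0.
split=> K l.
  by rewrite tS dual_actM dual_act_t opT0 K -addrA (addrC 1).
have := K (l - 1); rewrite tS dual_actM dual_act_t opT0 subrK => ->.
by rewrite (addrC k) addrA subrK.
Qed.

Lemma act_gV j F k : (j < n)%N -> act (g j.+1)^-1 F j k = F j.+1 k.
Proof.
move=> jn; rewrite -[F in RHS](dual_act1 n0) -(divrr (gU j.+1)) dual_actM.
by rewrite dual_act_g // opG_diag.
Qed.

Lemma act_ginv_prod i F k : (i <= n)%N -> act (ginv_prod g i.+1) F 0%N k = F i k.
Proof.
elim: i F => [|i IHi] F iN; first by rewrite ginv_prod1 dual_act1.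
by rewrite ginv_prodS // dual_actM IHi ?act_gV // ltnW.
Qed.

(** From (n,0), the factors g_n, ..., g_1 lead down to row 0, t^k shifts the exponent to k, and
    g_1^-1, ..., g_i^-1 lead up to row i. *)
Lemma act_belt F i k : (i <= n)%N -> act (belt n t g i k) F n 0 = F i k.
Proof.
move=> iN; rewrite /belt !dual_actM act_gcox // act_exprz add0r.
exact: act_ginv_prod.
Qed.

(** At (n,0) the letters of H_n act by left multiplication: g_j because j < n, and t because the
    correction terms of [opT] cancel at k = 0. *)
Lemma act_incl a F : act (hecke_incl p n a) F n 0 = a * F n 0.
Proof.
have letter b F' : (b < n)%N ->
    act (hecke_incl p n (braid_img p (braid_gen n b))) F' n 0 =
    braid_img p (braid_gen n b) * F' n 0.
  move=> bn; rewrite hecke_incl_img braid_incl_gen //; case: b bn => [_|b bn].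
    rewrite -/(tH p n.+1) dual_act_t.
    by apply: opT_exp0; rewrite n0 leqnn.
  rewrite -/(gH p n.+1 b.+1) dual_act_g; last by rewrite /= ltnW.
  exact: opG_gt.
move: a F; apply: hecke_rind => [|c x y Hx Hy|x i im Hx|x i im Hx] F.
- by rewrite rmorph1 dual_act1 mul1r.
- have -> : hecke_incl p n (c *: x + y) = c *: hecke_incl p n x + hecke_incl p n y.
    have eZ : hecke_incl p n (c *: x) = c *: hecke_incl p n x := hecke_incl_scalable c x.
    by rewrite (rmorphD (hecke_incl p n)); congr (_ + _); apply: eZ.
  rewrite dual_actD dual_actZ.
  by rewrite mulr_linear_l -Hx -Hy.
- rewrite (rmorphM (hecke_incl p n)) dual_actM Hx -[RHS](mulrA x).
  by apply: (congr1 ( *%R x)); apply: letter.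
- rewrite (rmorphM (hecke_incl p n)) dual_actM Hx -(mulrA x); congr (_ * _).
  (* For an inverse letter, the case of the letter itself is applied to the family obtained from [F]
     by the action of b^-1. *)
  set b := braid_img _ _; have bU : b \is a GRing.unit by apply: braid_img_unit.
  have eF : act (hecke_incl p n b) (act (hecke_incl p n b^-1) F) = F.
    rewrite -dual_actM -(rmorphM (hecke_incl p n)) (divrr bU).
    by rewrite (rmorph1 (hecke_incl p n)) dual_act1.
  have letter_b G : act (hecke_incl p n b) G n 0 = b * G n 0 := letter i G im.
  apply: etrans (esym (mulKr bU _)) _.
  apply: etrans (congr1 ( *%R b^-1) (esym (letter_b _))) _.
  exact: (congr1 (fun G : V => b^-1 * G n 0) eF).
Qed.

End Evaluation.

(** * Bases from coordinate functionals *)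

Section LeftBasis.
Variables (R : comNzRingType) (A : pzRingType) (B : algType R) (f : {rmorphism A -> B}).
Variables (I : choiceType) (e : I -> B).

Definition in_range (T : Type) (U : Type) (h : T -> U) (y : U) := exists x, y = h x.

Lemma lspan_fsfun x : lspan (in_range f) (in_range e) x ->
  exists c : {fsfun I -> A with 0}, x = \sum_(i <- finsupp c) f (c i) * e i.
Proof.
have widen (c : {fsfun I -> A with 0}) (D : {fset I}) : (finsupp c `<=` D)%fset ->
    \sum_(i <- finsupp c) f (c i) * e i = \sum_(i <- D) f (c i) * e i.
  move=> cD; apply: big_fset_incl => // i _; rewrite memNfinsupp => /eqP ->.
  by rewrite rmorph0 mul0r.
have sub (D : {fset I}) (h : I -> A) :
    (finsupp ([fsfun j in D => h j] : {fsfun I -> A with 0}) `<=` D)%fset.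
  by apply/fsubsetP => i; rewrite mem_finsupp fsfunE; case: ifP; rewrite ?eqxx.
elim=> {x} [_ _ [a ->] [i ->]||x y _ [c ->] _ [d ->]].
- exists [fsfun j in [fset i]%fset => a]; rewrite (widen _ _ (sub _ _)).
  by rewrite big_seq_fset1 fsfunE inE eqxx.
- by exists [fsfun]; rewrite finsupp0 big_seq_fset0.
- exists [fsfun j in (finsupp c `|` finsupp d)%fset => c j + d j].
  rewrite (widen _ _ (sub _ _)).
  rewrite (widen c (finsupp c `|` finsupp d)%fset) ?fsubsetUl //.
  rewrite (widen d (finsupp c `|` finsupp d)%fset) ?fsubsetUr //.
  rewrite -big_split big_seq [RHS]big_seq; apply: eq_bigr => i iD.
  by rewrite fsfunE iD rmorphD mulrDl.
Qed.

(** Spanning gives existence; the coordinate function of i, applied to any expansion, returns its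
    coefficient at i, whence uniqueness. *)
Lemma left_basis_dual :
  (forall x, lspan (in_range f) (in_range e) x) ->
  (forall i, exists h : B -> A, [/\ forall x y, h (x + y) = h x + h y,
     forall a x, h (f a * x) = a * h x & forall j, h (e j) = (j == i)%:R]) ->
  left_basis f e.
Proof.
move=> span coord x; have [c cE] := lspan_fsfun (span x).
exists c; split=> // d dE; apply/fsfunP => i.
have [h [hD hM he]] := coord i.
have h0 : h 0 = 0 by have := hM 0 0; rewrite mulr0 mul0r.
suff hE (b : {fsfun I -> A with 0}) : h (\sum_(j <- finsupp b) f (b j) * e j) = b i.
  by rewrite -hE -cE dE hE.
rewrite (big_morph h hD h0).
rewrite (eq_bigr (fun j => if j == i then b j else 0)) => [|j _]; last first.
  by rewrite hM he; case: eqP => _; rewrite ?mulr1 ?mulr0.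
rewrite -big_mkcond /=; have [ib|ib] := boolP (i \in finsupp b).
  by rewrite -big_filter filter_pred1_uniq ?fset_uniq // big_seq1.
rewrite big_seq_cond big_pred0 => [|j].
  by move: ib; rewrite memNfinsupp => /eqP.
by apply/negP => /andP[jb /eqP ji]; rewrite -ji jb in ib.
Qed.
End LeftBasis.

(** * The basis of H_(n+1) over H_n *)

Section HeckeBasis.
Variables (p : level) (n : nat).
Hypothesis n0 : (0 < n)%N.
Notation f := (hecke_incl p n).
Notation e := (fun w : basis_index p n => basis_elt p n (val w)).
Let L := in_range f.
Notation t := (tH p n.+1).
Notation g := (gH p n.+1).
Let hs := hecke_is_system p n.+1.

Let LM l l' : L l -> L l' -> L (l * l').
Proof. by case=> a -> [b ->]; exists (a * b); rewrite (rmorphM f). Qed.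

Let LZ a : L a%:A.
Proof.
exists a%:A; apply: esym; apply: etrans (hecke_incl_scalable a 1) _.
by rewrite (rmorph1 f).
Qed.

Let f_gen j : (j < n)%N -> f (braid_img p (braid_gen n j)) = braid_img p (braid_gen n.+1 j).
Proof. by move=> jn; rewrite hecke_incl_img braid_incl_gen. Qed.

Let Lg j : (0 < j < n)%N -> L (g j).
Proof. by case/andP=> _ jn; exists (gH p n j); rewrite f_gen. Qed.

Let Lt (k : int) : L (t ^ k).
Proof.
have U : tH p n \is a GRing.unit by apply: braid_img_unit.
have ft : t = f (tH p n) := esym (f_gen n0).
exists (tH p n ^ k).
exact: etrans (congr1 (fun x => x ^ k) ft) (esym (rmorphXz f k U)).
Qed.

Let belt_spans x : lspan L (is_belt n t g) x.
Proof.
move: x; apply: hecke_rind => [|a x y Sx Sy|x [|i] im Sx|x [|i] im Sx].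
(* The unit is b(n,0), since [gcox n] is inverse to P_(n+1). *)
- rewrite -[X in lspan _ _ X](gcoxK qL_mulV hs (ltnSn n)) -[gcox g n]mulr1.
  rewrite -(expr0z t); exact: belt_span.
- by apply: LspanD => //; apply: lspanZ.
- exact: (span_t qL_mulV hs).
- exact: (span_g qL_mulV hs).
- exact: (span_tV qL_mulV hs).
- exact: (span_gV qL_mulV hs).
Qed.

Let tcyc : if level_vars p is Some us then \prod_(v <- us) (t - v%:A) = 0 else True :=
  @hecke_cyclotomic p n.+1 (ltn0Sn n).

Lemma level_varsP : (forall k, k \in exponent p) \/ exists us, [/\ level_vars p = Some us,
   all (fun v => `[< exists w : laurent, w * v = 1 >]) us
   & forall j : nat, (j < size us)%N -> Posz j \in exponent p].
Proof.
rewrite /level_vars; case: p => [|d d0]; [by left | right].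
exists [seq uL j | j <- index_iota 1 d.+1]; split=> //.
  by apply/allP => v /mapP[j _ ->]; apply/asboolP/uL_unit.
by move=> j; rewrite size_map size_iota subn1 inE.
Qed.

(** In the infinite case every b(i,k) is a basis element. In the cyclotomic case b(i,k) satisfies
    the recurrence in k, so [recurrent_span] reduces all integers k to 0, ..., d-1. *)
Let belt_basis b : is_belt n t g b -> lspan L (in_range e) b.
Proof.
case=> i [k [iN ->]].
have base l : l \in exponent p -> lspan L (in_range e) (belt n t g i l).
  move=> lp; have [w wp [wi wl]] := basis_word_of n0 iN lp.
  apply: (lspan_base LZ); exists (exist _ w wp).
  by rewrite /= (basis_eltE wp) wi wl.
have [|[us [usE usU usP]]] := level_varsP; first by move=> /(_ k) /base.
have t0 : \prod_(v <- us) (t - v%:A) = 0 by move: tcyc; rewrite usE.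
apply: (@recurrent_span _ _ us (belt n t g i)) => //.
- exact: Lspan0.
- by move=> a x y Sx Sy; apply: LspanD => //; apply: lspanZ.
- by apply: recurrent_exprz; rewrite ?t0 ?mul0r //; apply: braid_img_unit.
- by move=> j /usP /base.
Qed.

Lemma hecke_left_basis : left_basis f e.
Proof.
apply: left_basis_dual => [x|w].
  exact: (lspan_sub LM belt_basis (belt_spans x)).
have wi := basis_row_le (valP w); have wk := basis_exp_in (valP w).
have [F FE] := dual_delta wi wk.
exists (fun x => dual_act n0 x F n 0); split=> [x y|a x|w'].
- by rewrite dual_actD.
- by rewrite dual_actM act_incl.
have wi' := basis_row_le (valP w'); have wk' := basis_exp_in (valP w').
rewrite (basis_eltE (valP w')) act_belt // FE //.
congr (_%:R); congr nat_of_bool; apply/andP/eqP => [[/eqP ei /eqP ek]|->] //.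
by apply/val_inj/(basis_row_exp_inj n0 (valP w') (valP w)).
Qed.

End HeckeBasis.

Theorem theorem4 (n : nat) (hn : (1 <= n)%N) :
  left_basis (hecke_incl Infinite n)
    (fun w : basis_index Infinite n => basis_elt Infinite n (val w)) /\
  (forall (d : nat) (hd : (0 < d)%N),
    left_basis (hecke_incl (Cyclotomic hd) n)
      (fun w : basis_index (Cyclotomic hd) n =>
         basis_elt (Cyclotomic hd) n (val w))).
Proof. by split=> [|d hd]; apply: hecke_left_basis. Qed.
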